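(* Let $M,N$ be two finitely presented $2$-parameter persistence modules. If $M$ and $N$ are both trivial (zero), then $d_{match}(M,N)=0$. Otherwise, assume that $M$ and $N$ satisfy Properties (P) and (Q): let $C_M$ and $C_N$ be finite sets of critical values in $\mathbb{R}^2$ as in Property (P), and let $\Omega=\Omega(C_M,C_N)$ be a finite set of points as in Property (Q). Put $\Omega_P=\Omega\cap\mathbb{R}^2$ and $\overline{\Omega}=\Omega\cup\{[0:1:1]\}$. Then the matching distance between $M$ and $N$ is achieved on a line through two distinct points, one in $\overline{C}_M\cup\overline{C}_N\cup\Omega_P$ and the other in $\overline{C}_M\cup\overline{C}_N\cup\overline{\Omega}$; that is, there is a line $L$ with positive slope passing through two such points with $d_{match}(M,N)=\hat m^L\, d_B(\mathrm{dgm}\,M^L,\mathrm{dgm}\,N^L)$.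
   Context: **Modules.** $\mathbb{R}^2$ has the partial order $u\preceq v$ iff $u_1\le v_1$ and $u_2\le v_2$. Fix a field $\mathbb{F}$. A $2$-parameter persistence module $M$ is a functor from $(\mathbb{R}^2,\preceq)$ to $\mathbb{F}$-vector spaces, with transition maps $i_M(u,v):M_u\to M_v$ for $u\preceq v$. All modules are finitely presented. **Lines.** A line $L\subset\mathbb{R}^2$ with positive slope is parameterized as $u=\vec m s+b$, $s\in\mathbb{R}$, with $m_1,m_2>0$ and the standard normalization $\max\{m_1,m_2\}=1$, $b_1+b_2=0$. Put $\hat m^L=\min\{m_1,m_2\}$. The restriction $M^L$ is the $1$-parameter module $(M^L)_s=M_{\vec m s+b}$ with the induced maps. It decomposes as a finite direct sum of interval modules $I[b_j,d_j)$, $b_j<d_j\le\infty$; $\mathrm{dgm}\,M^L$ is the finite multiset of the points $(b_j,d_j)\in\mathbb{R}\times(\mathbb{R}\cup\{\infty\})$. **Bottleneck and matching distance.** A matching between $\mathrm{dgm}\,M^L$ and $\mathrm{dgm}\,N^L$ is a multi-bijection $\sigma:P\to Q$ between multi-subsets $P\subseteq\mathrm{dgm}\,M^L$, $Q\subseteq\mathrm{dgm}\,N^L$. Its cost $c(\sigma)$ is the maximum of $\|p-\sigma(p)\|_\infty$ over $p\in P$ and of $(p_2-p_1)/2$ over the points $p=(p_1,p_2)$ of either diagram left unmatched, with $\infty-\infty=0$ and $\infty-a=\infty$ for $a\in\mathbb{R}$ (maximum over the empty set is $0$). $d_B$ is the minimum of $c(\sigma)$ over all matchings. $d_{match}(M,N)=\sup_L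 \hat m^L d_B(\mathrm{dgm}\,M^L,\mathrm{dgm}\,N^L)$ over all lines $L$ with positive slope. **Pushes and reciprocal position.** For $u\in\mathbb{R}^2$ and $L$ of positive slope, $L$ meets the boundary of $\{v: u\preceq v\}$ in exactly one point $\mathrm{push}_L(u)$, and $p_L(u)\in\mathbb{R}$ denotes its parameter: $\mathrm{push}_L(u)=\vec m\,p_L(u)+b$. Set $A^L_u=\{1,2\}$ if $u\in L$; $A^L_u=\{1\}$ if $\mathrm{push}_L(u)=(u_1,y)$ with $y>u_2$ ($u$ strictly right of $L$); $A^L_u=\{2\}$ if $\mathrm{push}_L(u)=(x,u_2)$ with $x>u_1$ ($u$ strictly left of $L$). Let $\mathbb{P}^2=\mathbb{R}^2\cup\ell_\infty$, points at infinity being written $[0:x_1:x_2]$; a line with direction $\vec m$ passes through $[0:m_1:m_2]$. For $v=[0:v_1:v_2]$ with $v_1,v_2>0$, set $A^L_v=\{1,2\}$ if $[0:m_1:m_2]=v$, $\{1\}$ if $m_2/m_1>v_2/v_1$, $\{2\}$ if $m_2/m_1<v_2/v_1$. For a set $U$ of such points, $L\sim_U L'$ iff $A^L_u=A^{L'}_u$ for all $u\in U$. **Property (P)** of $M$: there is a finite set $C_M\subset\mathbb{R}^2$ (critical values; empty iff $M$ is trivial) such that, with $\overline{C}_M$ its closure under least upper bounds, for all $u\preceq v$: $\mathrm{rank}\,i_M(u,v)=\mathrm{rank}\,i_M(\bar u,\bar v)$ where $\bar u=\max\{u'\in\overline{C}_M: u'\preceq u\}$ and $\bar v=\max\{v'\in\overline{C}_M:v'\preceq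 v\}$, if $\{u'\in\overline{C}_M:u'\preceq u\}\ne\emptyset$, and $\mathrm{rank}\,i_M(u,v)=0$ otherwise. **Property (Q)** of $M,N$ (with given $C_M,C_N$): there is a finite set $\Omega=\Omega(C_M,C_N)\subset\mathbb{P}^2$, whose points at infinity are of the form $[0:v_1:v_2]$ with $v_1,v_2>0$, such that for all $u,v,w,x\in\overline{C}_M\cup\overline{C}_N$ and $\delta,\eta\in\{1,2\}$ (not necessarily distinct), the sign (positive, negative or zero) of $\frac{|p_L(u)-p_L(v)|}{\delta}-\frac{|p_L(w)-p_L(x)|}{\eta}$ is the same for all lines $L$ of positive slope in the same $\sim_{\overline{C}_M\cup\overline{C}_N\cup\Omega}$-equivalence class. *)

(* Defs.v *)
From HB Require Import structures.
From mathcomp Require Import all_boot all_order all_algebra.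
From mathcomp Require Import all_classical all_reals all_analysis.
Set Implicit Arguments.
Unset Strict Implicit.
Unset Printing Implicit Defensive.
Import Order.TTheory GRing.Theory Num.Theory numFieldNormedType.Exports.

Local Open Scope classical_set_scope.
Local Open Scope ring_scope.

(* Persistence modules over a poset T: functors from T to finite dimensional
   F-vector spaces (a finitely presented module is pointwise finite
   dimensional). *)
Record pmod (d : Order.disp_t) (T : porderType d) (F : fieldType) := Pmod {
  pm_sp :> T -> vectType F;
  pm_map : forall u v : T, (u <= v)%O -> 'Hom(pm_sp u, pm_sp v);
  pm_id : forall (u : T) (h : (u <= u)%O), pm_map h = \1%VF;
  pm_comp : forall (u v w : T) (huv : (u <= v)%O) (hvw : (v <= w)%O)
      (huw : (u <= w)%O),
    (pm_map hvw \o pm_map huv)%VF = pm_map huw }.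
Arguments pm_map {d T F} p {u v} h.

Section PersistenceModules.
Context {d : Order.disp_t} {T : porderType d} {F : fieldType}.
Implicit Types M N : pmod T F.

Definition pm_trivial M : Prop := forall (u : T) (x : M u), x = 0.

Definition pm_rank M (u v : T) (h : (u <= v)%O) : nat :=
  \dim (limg (pm_map M h)).

Definition pm_natural M N (f : forall u, 'Hom(M u, N u)) : Prop :=
  forall (u v : T) (h : (u <= v)%O),
    (f v \o pm_map M h)%VF = (pm_map N h \o f u)%VF.

Definition pm_iso M N : Prop :=
  exists2 f : forall u, 'Hom(M u, N u),
    pm_natural f & forall u, bijective (f u).

Definition convex_pred (S : pred T) : Prop :=
  forall u v w, (u <= v)%O -> (v <= w)%O -> S u -> S w -> S v.

(* The module equal to F on the convex set S and to 0 elsewhere, with identity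
   maps inside S: here S u : bool is read as the dimension 0 or 1. *)
Section Indicator.
Variables (S : pred T) (cS : convex_pred S).

Definition ind_sp (u : T) : vectType F := 'rV[F]_(S u).
Definition ind_map (u v : T) (h : (u <= v)%O) : 'Hom(ind_sp u, ind_sp v) :=
  linfun (mulmxr (pid_mx 1 : 'M[F]_(S u, S v))).

Lemma ind_map_id (u : T) (h : (u <= u)%O) : ind_map h = \1%VF.
Proof.
apply/lfunP => x; rewrite lfunE id_lfunE /=.
suff -> : (pid_mx 1 : 'M[F]_(S u)) = 1%:M by rewrite mulmx1.
by case: (S u); rewrite ?pid_mx_1 // [LHS]flatmx0 [RHS]flatmx0.
Qed.

Lemma ind_map_comp (u v w : T) (huv : (u <= v)%O) (hvw : (v <= w)%O)
    (huw : (u <= w)%O) : (ind_map hvw \o ind_map huv)%VF = ind_map huw.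
Proof.
apply/lfunP => x; rewrite comp_lfunE !lfunE /= -mulmxA; congr (_ *m _).
rewrite mul_pid_mx; have := cS huv hvw.
case: (S u) (S v) (S w) => [] [] [] //= c; rewrite ?minnn //;
  by [have := c isT isT | rewrite [LHS]thinmx0 [RHS]thinmx0
     | rewrite [LHS]flatmx0 [RHS]flatmx0].
Qed.

Definition ind_pmod : pmod T F := Pmod ind_map_id ind_map_comp.
End Indicator.

Section DirectSum.
Variables M N : pmod T F.

Definition dsum_sp (u : T) : vectType F := (M u * N u)%type.

Definition dsum_fun (u v : T) (h : (u <= v)%O) (x : dsum_sp u) : dsum_sp v :=
  (pm_map M h x.1, pm_map N h x.2).

Fact dsum_fun_linear (u v : T) (h : (u <= v)%O) : linear (dsum_fun h).
Proof. by move=> a x y; rewrite /dsum_fun !linearP. Qed.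

HB.instance Definition _ (u v : T) (h : (u <= v)%O) :=
  GRing.isLinear.Build F (dsum_sp u) (dsum_sp v) _ (dsum_fun h)
    (dsum_fun_linear h).

Definition dsum_map (u v : T) (h : (u <= v)%O) : 'Hom(dsum_sp u, dsum_sp v) :=
  linfun (dsum_fun h).

Lemma dsum_map_id (u : T) (h : (u <= u)%O) : dsum_map h = \1%VF.
Proof.
apply/lfunP => -[x y]; rewrite lfunE id_lfunE /=.
by rewrite /dsum_fun !pm_id !id_lfunE.
Qed.

Lemma dsum_map_comp (u v w : T) (huv : (u <= v)%O) (hvw : (v <= w)%O)
    (huw : (u <= w)%O) : (dsum_map hvw \o dsum_map huv)%VF = dsum_map huw.
Proof.
apply/lfunP => -[x y]; rewrite comp_lfunE !lfunE /=.
by rewrite /dsum_fun /= -(pm_comp M huv hvw huw) -(pm_comp N huv hvw huw)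
  !comp_lfunE.
Qed.

Definition dsum_pmod : pmod T F := Pmod dsum_map_id dsum_map_comp.
End DirectSum.

Lemma convex_pred0 : convex_pred (pred0 : pred T).
Proof. by []. Qed.

Definition zero_pmod : pmod T F := ind_pmod convex_pred0.

Definition big_dsum (s : seq (pmod T F)) : pmod T F :=
  foldr dsum_pmod zero_pmod s.

Lemma convex_up (g : T) : convex_pred (fun u => (g <= u)%O).
Proof. by move=> u v w uv _ gu _; exact: le_trans uv. Qed.

Definition free_pmod (gs : seq T) : pmod T F :=
  big_dsum [seq ind_pmod (@convex_up g) | g <- gs].

(* Existence of an exact sequence P1 -> P0 -> M -> 0 of modules, with P1 and
   P0 free and finitely generated. *)
Definition finitely_presented M : Prop :=
  exists (gs rs : seq T)
    (f : forall u, 'Hom(free_pmod rs u, free_pmod gs u))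
    (e : forall u, 'Hom(free_pmod gs u, M u)),
    [/\ pm_natural f, pm_natural e &
        forall u, limg (f u) = lker (e u) /\ limg (e u) = fullv].

End PersistenceModules.

Section Restriction.
Context {d d' : Order.disp_t} {T : porderType d} {T' : porderType d'}.
Context {F : fieldType}.
Variables (M : pmod T F) (g : T' -> T).
Hypothesis g_homo : {homo g : s t / (s <= t)%O}.

Definition restr_map (s t : T') (h : (s <= t)%O) : 'Hom(M (g s), M (g t)) :=
  pm_map M (g_homo h).

Lemma restr_id (s : T') (h : (s <= s)%O) : restr_map h = \1%VF.
Proof. exact: pm_id. Qed.

Lemma restr_comp (s t r : T') (h1 : (s <= t)%O) (h2 : (t <= r)%O)
    (h3 : (s <= r)%O) : (restr_map h2 \o restr_map h1)%VF = restr_map h3.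
Proof. exact: pm_comp. Qed.

Definition restr_pmod : pmod T' F :=
  @Pmod _ _ _ (fun s => M (g s)) restr_map restr_id restr_comp.
End Restriction.

Section Diagrams.
Context {R : realType} {F : fieldType}.

Definition dpoint : Type := (R * \bar R)%type.

Definition in_bar (p : dpoint) : pred R :=
  fun s => (p.1 <= s) && (s%:E < p.2)%E.

Lemma convex_bar (p : dpoint) : convex_pred (in_bar p).
Proof.
move=> u v w uv vw /andP[pu _] /andP[_ wp]; apply/andP; split.
  exact: le_trans uv.
by apply: le_lt_trans wp; rewrite lee_fin.
Qed.

Definition interval_pmod (p : dpoint) : pmod R F := ind_pmod (@convex_bar p).

Definition is_dgm (V : pmod R F) (D : seq dpoint) : Prop :=
  all (fun p => (p.1%:E < p.2)%E) D /\
  pm_iso V (big_dsum [seq interval_pmod p | p <- D]).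

(* Multisets are represented by sequences.  The decomposition is unique up to
   order, so any choice of D gives the same bottleneck distances. *)
Definition dgm (V : pmod R F) : seq dpoint := xget [::] [set D | is_dgm V D].

End Diagrams.

Section Bottleneck.
Context {R : realType}.
Local Open Scope ereal_scope.
Local Notation dpt := (@dpoint R).

(* oo - oo = 0 here, unlike in \bar R *)
Definition death_dist (x y : \bar R) : \bar R :=
  if x == y then 0 else `|x - y|.

Definition dpoint_dist (p q : dpt) : \bar R :=
  maxe (`|p.1 - q.1|%R)%:E (death_dist p.2 q.2).

Definition half_pers (p : dpt) : \bar R := (p.2 - p.1%:E) * (2^-1)%:E.

Variables D E : seq dpt.

Definition is_matching (s : {ffun 'I_(size D) -> option 'I_(size E)}) : bool :=
  [forall i, forall j, (s i != None) && (s i == s j) ==> (i == j)].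

Definition matching_cost (s : {ffun 'I_(size D) -> option 'I_(size E)}) :
    \bar R :=
  maxe
    (\big[maxe/0]_(i < size D)
       match s i with
       | Some j => dpoint_dist (tnth (in_tuple D) i) (tnth (in_tuple E) j)
       | None => half_pers (tnth (in_tuple D) i)
       end)
    (\big[maxe/0]_(j < size E | [forall i, s i != Some j])
       half_pers (tnth (in_tuple E) j)).

Definition bottleneck : \bar R :=
  \big[mine/+oo]_(s : {ffun 'I_(size D) -> option 'I_(size E)} | is_matching s)
    matching_cost s.

End Bottleneck.

(* The plane with the product order. *)
Definition plane (R : realType) := (R *p R)%type.

Record line (R : realType) := Line {
  ldir : R * R;
  loff : R * R;
  ldir1_gt0 : 0 < ldir.1;
  ldir2_gt0 : 0 < ldir.2;
  ldir_max : Num.max ldir.1 ldir.2 = 1;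
  loff_sum : loff.1 + loff.2 = 0 }.

(* Points of the projective plane; Infty v is [0 : v.1 : v.2], so that
   proportional nonzero v represent the same point, and v = 0 none. *)
Inductive ppoint (R : realType) := Affine of plane R | Infty of R * R.

Section Lines.
Context {R : realType}.
Implicit Types (L : line R) (u v : plane R) (p : ppoint R).

Definition lpoint L (s : R) : plane R :=
  ((ldir L).1 * s + (loff L).1, (ldir L).2 * s + (loff L).2).

Lemma lpoint_homo L : {homo lpoint L : s t / (s <= t)%O}.
Proof.
move=> s t st; rewrite leEprod /= !lerD2r.
by rewrite !ler_pM2l ?st // ?ldir1_gt0 ?ldir2_gt0.
Qed.

Definition mhat L : R := Num.min (ldir L).1 (ldir L).2.

Definition on_line L p : Prop :=
  match p with
  | Affine u => exists s, lpoint L s = u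
  | Infty v => (ldir L).1 * v.2 = (ldir L).2 * v.1
  end.

Definition boundary (A : set (R * R)) : set (R * R) := closure A `\` interior A.

Definition is_push_param L u (s : R) : Prop :=
  boundary [set v : R * R | (u <= (v : plane R))%O] (lpoint L s : R * R).

Definition push_param L u : R := xget 0 [set s | is_push_param L u s].

Definition push L u : plane R := lpoint L (push_param L u).

(* The set A^L_p of coordinates; for p not on L, exactly one of the two other
   cases occurs. *)
Definition recip L p : set nat :=
  match p with
  | Affine u =>
      if `[< on_line L (Affine u) >] then [set 1; 2]%N
      else if ((push L u).1 == u.1) && (u.2 < (push L u).2) then [set 1]%N
      else [set 2]%N
  | Infty v =>
      if (ldir L).1 * v.2 == (ldir L).2 * v.1 then [set 1; 2]%N
      else if v.2 / v.1 < (ldir L).2 / (ldir L).1 then [set 1]%N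
      else [set 2]%N
  end.

Definition line_equiv (U : set (ppoint R)) L L' : Prop :=
  forall p, U p -> recip L p = recip L' p.

Definition lub_closure (C : set (plane R)) : set (plane R) :=
  smallest
    [set A : set (plane R) | forall u v, A u -> A v -> A (Order.join u v)] C.

Definition is_max_below (C : set (plane R)) u v : Prop :=
  [/\ C v, (v <= u)%O & forall w, C w -> (w <= u)%O -> (w <= v)%O].

End Lines.

Section MatchingDistance.
Context {R : realType} {F : fieldType}.
Implicit Types (M N : pmod (plane R) F) (L : line R).

Definition line_restr M L : pmod R F := restr_pmod M (@lpoint_homo R L).

Definition weighted_bottleneck M N L : \bar R :=
  ((mhat L)%:E * bottleneck (dgm (line_restr M L)) (dgm (line_restr N L)))%E.

Definition matching_distance M N : \bar R :=
  ereal_sup [set weighted_bottleneck M N L | L in [set: line R]].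

Definition propP M (C : set (plane R)) : Prop :=
  [/\ finite_set C,
      C = set0 <-> pm_trivial M &
      forall (u v : plane R) (h : (u <= v)%O),
        ([set w | lub_closure C w /\ (w <= u)%O] !=set0 ->
           exists (u' v' : plane R) (h' : (u' <= v')%O),
             [/\ is_max_below (lub_closure C) u u',
                 is_max_below (lub_closure C) v v' &
                 pm_rank M h = pm_rank M h']) /\
        ([set w | lub_closure C w /\ (w <= u)%O] = set0 -> pm_rank M h = 0%N)].

Definition propQ (CM CN : set (plane R)) (Omega : set (ppoint R)) : Prop :=
  let S := lub_closure CM `|` lub_closure CN in
  [/\ finite_set Omega,
      forall v, Omega (Infty v) -> 0 < v.1 /\ 0 < v.2 &
      forall (u v w x : plane R) (delta eta : nat),
        S u -> S v -> S w -> S x ->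
        delta \in [:: 1; 2]%N -> eta \in [:: 1; 2]%N ->
        forall L L', line_equiv ((@Affine R) @` S `|` Omega) L L' ->
          let diff K := `|push_param K u - push_param K v| / delta%:R
                        - `|push_param K w - push_param K x| / eta%:R in
          Num.sg (diff L) = Num.sg (diff L')].

End MatchingDistance.

(* Main.v *)
(** Idea. Write a line of slope at most 1 as [y = mu x + c], the steeper ones
    being obtained by exchanging the coordinates. Along it
    [mhat * push_param u = max (mu u.1 + c) u.2] up to a constant. Decomposing the
    restrictions of [M] and [N] names the points of the two diagrams by critical
    values; the names stay valid as long as the order of the values
    [push_param u] does not change, and also, weakly, at the limit of such lines.
    By (Q), while [(mu, c)] moves along a segment without changing the position of
    the line relative to the points of the configuration, one fixed triple
    [|p u - p v| / delta] realizes the bottleneck distance, and it remains a lower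
    bound at the ends of the segment. It is the absolute value of an affine
    function, hence convex, so the distance at an interior point is at most the
    larger of the values at both ends. Translating a line until it meets a point
    and then rotating it about that point ends at a line through two points of the
    configuration, or at the degenerate slope [mu = 0]. There the diagrams are the
    ones of the second coordinate truncated from below, and truncation is
    1-Lipschitz; so the value is at most the one at the diagonal line which lies
    below all points and meets one of them. Lines through two points being
    finitely many, the supremum is a maximum. *)

Require Import Defs.
From HB Require Import structures.
From mathcomp Require Import all_boot all_order all_algebra.
From mathcomp Require Import all_classical all_reals all_analysis.
From mathcomp Require Import ring lra.
Set Implicit Arguments.
Unset Strict Implicit.
Unset Printing Implicit Defensive.
Import Order.TTheory GRing.Theory Num.Theory numFieldNormedType.Exports.
Local Open Scope classical_set_scope.
Local Open Scope ring_scope.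

(** * Ranks of sums of interval modules *)

Section Ranks.
Context {F : fieldType}.

Section ProductMap.
Variables A B C D : vectType F.
Variables (f : 'Hom(A, C)) (g : 'Hom(B, D)).

Let inl_fun (x : C) : (C * D)%type := (x, 0).
Let inr_fun (x : D) : (C * D)%type := (0, x).

Fact inl_fun_linear : linear inl_fun.
Proof. by move=> a x y; congr pair; rewrite /= scaler0 addr0. Qed.
Fact inr_fun_linear : linear inr_fun.
Proof. by move=> a x y; congr pair; rewrite /= scaler0 addr0. Qed.
HB.instance Definition _ :=
  GRing.isLinear.Build F C (C * D)%type _ inl_fun inl_fun_linear.
HB.instance Definition _ :=
  GRing.isLinear.Build F D (C * D)%type _ inr_fun inr_fun_linear.

Lemma dim_limg_prod (h : 'Hom((A * B)%type, (C * D)%type)) :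
  (forall x, h x = (f x.1, g x.2)) ->
  \dim (limg h) = (\dim (limg f) + \dim (limg g))%N.
Proof.
move=> hE; pose l := linfun inl_fun; pose r := linfun inr_fun.
have lE x : l x = (x, 0) by rewrite lfunE.
have rE x : r x = (0, x) by rewrite lfunE.
have -> : limg h = (l @: limg f + r @: limg g)%VS.
  apply/eqP; rewrite eqEsubv; apply/andP; split; apply/subvP.
    move=> _ /memv_imgP[x _ ->]; rewrite hE.
    have -> : (f x.1, g x.2) = l (f x.1) + r (g x.2).
      by rewrite lE rE; congr pair; rewrite /= ?addr0 ?add0r.
    by rewrite memv_add // memv_img // memv_img // memvf.
  move=> z /memv_addP[_ /memv_imgP[_ /memv_imgP[x _ ->] ->]].
  case=> _ /memv_imgP[_ /memv_imgP[y _ ->] ->] ->.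
  have -> : l (f x) + r (g y) = h (x, y).
    by rewrite lE rE hE; congr pair; rewrite /= ?addr0 ?add0r.
  by rewrite memv_img // memvf.
rewrite dimv_disjoint_sum; last first.
  apply/eqP; rewrite -subv0; apply/subvP => z; rewrite memv_cap => /andP[].
  move=> /memv_imgP[x _ ->] /memv_imgP[y _]; rewrite lE rE => -[-> _].
  by rewrite mem0v.
rewrite (@limg_dim_eq _ _ _ l) ?(@limg_dim_eq _ _ _ r) //;
  apply/eqP; rewrite -subv0; apply/subvP => z;
  rewrite memv_cap memv_ker ?lE ?rE => /andP[_ /eqP[->]]; exact: mem0v.
Qed.
End ProductMap.

Context {d : Order.disp_t} {T : porderType d}.
Implicit Types V W : pmod T F.

Lemma pm_rank_irr V (s t : T) (h h' : (s <= t)%O) : pm_rank V h = pm_rank V h'.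
Proof. by congr pm_rank; exact: eq_irrelevance. Qed.

Lemma pm_rank_iso V W (s t : T) (h : (s <= t)%O) :
  pm_iso V W -> pm_rank V h = pm_rank W h.
Proof.
case=> f fnat fbij; rewrite /pm_rank.
have ker0 u : lker (f u) == 0%VS by apply/lker0P; exact: bij_inj.
have img1 u : limg (f u) = fullv.
  apply/eqP; rewrite eqEsubv subvf; apply/subvP => x _.
  by have [g _ fK] := fbij u; rewrite -(fK x) memv_img // memvf.
have := congr1 (fun k => \dim (limg k)) (fnat _ _ h).
rewrite /= !limg_comp img1 limg_dim_eq // .
by apply/eqP; rewrite -subv0 (eqP (ker0 t)) capvSr.
Qed.

Lemma pm_rank_dsum V W (s t : T) (h : (s <= t)%O) :
  pm_rank (dsum_pmod V W) h = (pm_rank V h + pm_rank W h)%N.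
Proof. by apply: dim_limg_prod => x; rewrite lfunE. Qed.

Lemma pm_rank_ind (S : pred T) (cS : convex_pred S) (s t : T) (h : (s <= t)%O) :
  pm_rank (ind_pmod (F := F) cS) h = (S s && S t).
Proof.
rewrite /pm_rank /= /ind_map /ind_sp.
case: (S s) (S t) => [] [] /=; last 3 first.
- apply/eqP; rewrite -leqn0 (leq_trans (dimvS (subvf _))) //.
  by rewrite dimvf dim_matrix.
- apply/eqP; rewrite dimv_eq0 -subv0; apply/subvP => _ /memv_imgP[x _ ->].
  by rewrite [x]thinmx0 linear0 mem0v.
- apply/eqP; rewrite dimv_eq0 -subv0; apply/subvP => _ /memv_imgP[x _ ->].
  by rewrite [x]thinmx0 linear0 mem0v.
rewrite (_ : linfun _ = \1%VF); first by rewrite lim1g dimvf dim_matrix.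
by apply/lfunP => x; rewrite lfunE id_lfunE /= pid_mx_1 mulmx1.
Qed.

Lemma pm_rank_zero (s t : T) (h : (s <= t)%O) :
  pm_rank (zero_pmod (F := F)) h = 0%N.
Proof. exact: pm_rank_ind. Qed.

End Ranks.

(** These are the bars that contribute to the rank of the map from [s] to [t]. *)
Definition alive {R : realType} (s t : R) (p : @dpoint R) : bool :=
  (p.1 <= s) && (t%:E < p.2)%E.

Section DiagramRanks.
Context {R : realType} {F : fieldType}.
Implicit Types (V : pmod R F) (D : seq (@dpoint R)).

Lemma pm_rank_bars D (s t : R) (h : (s <= t)%O) :
  pm_rank (big_dsum [seq interval_pmod (F := F) p | p <- D]) h
  = count (alive s t) D.
Proof.
elim: D => [|p D IH] /=; first exact: pm_rank_zero.
rewrite pm_rank_dsum IH pm_rank_ind /in_bar /alive; congr (nat_of_bool _ + _)%N.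
case: (leP p.1 s) => //= ps; rewrite (le_trans ps h) /=.
case: (boolP (t%:E < p.2)%E) => tp; last by rewrite andbF.
by rewrite (le_lt_trans _ tp) // lee_fin.
Qed.

Lemma pm_rank_dgm V D (s t : R) (h : (s <= t)%O) :
  is_dgm V D -> pm_rank V h = count (alive s t) D.
Proof. by move=> [_ /pm_rank_iso ->]; rewrite pm_rank_bars. Qed.

End DiagramRanks.

Lemma seq_argmax {d : Order.disp_t} {T : orderType d} {A : eqType} (f : A -> T)
    (P : pred A) (s : seq A) :
  has P s ->
  exists x, [/\ x \in s, P x & forall y, y \in s -> P y -> (f y <= f x)%O].
Proof.
elim: s => //= a s IH; case: (boolP (has P s)) => [/IH[x [xs Px xmax]] _|hasN].
  have [/andP[Pa lt_xa]|nPa] := boolP (P a && (f x < f a)%O).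
    exists a; split=> //; first exact: mem_head.
    move=> y; rewrite inE => /orP[/eqP-> //|ys Py].
    exact: le_trans (xmax y ys Py) (ltW lt_xa).
  exists x; split=> //; first by rewrite inE xs orbT.
  move=> y; rewrite inE => /orP[/eqP->|ys Py]; last exact: xmax.
  by move=> Pa; rewrite Pa -leNgt in nPa.
rewrite orbF => Pa; exists a; split=> //; first exact: mem_head.
move=> y; rewrite inE => /orP[/eqP-> //|ys Py].
by case/hasP: hasN; exists y.
Qed.

Lemma seq_argmin {d : Order.disp_t} {T : orderType d} {A : eqType} (f : A -> T)
    (P : pred A) (s : seq A) :
  has P s ->
  exists x, [/\ x \in s, P x & forall y, y \in s -> P y -> (f x <= f y)%O].
Proof. exact: (@seq_argmax _ T^d _ f). Qed.

(** * Submodules and direct summands *)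

Section Submodule.
Context {d : Order.disp_t} {T : porderType d} {F : fieldType}.
Variables (V : pmod T F) (W : forall s, {vspace V s}).
Hypothesis stableW : forall (s t : T) (h : (s <= t)%O) x,
  x \in W s -> pm_map V h x \in W t.

Definition sub_map (s t : T) (h : (s <= t)%O) :
    'Hom(subvs_of (W s), subvs_of (W t)) :=
  linfun (vsproj (W t) \o pm_map V h \o vsval).

Lemma vsval_sub_map (s t : T) (h : (s <= t)%O) x :
  vsval (sub_map h x) = pm_map V h (vsval x).
Proof. by rewrite lfunE /= vsprojK // stableW // subvsP. Qed.

Lemma sub_map_id (s : T) (h : (s <= s)%O) : sub_map h = \1%VF.
Proof.
by apply/lfunP => x; apply: subvs_inj; rewrite vsval_sub_map pm_id !id_lfunE.
Qed.

Lemma sub_map_comp (s t r : T) (h1 : (s <= t)%O) (h2 : (t <= r)%O)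
    (h3 : (s <= r)%O) : (sub_map h2 \o sub_map h1)%VF = sub_map h3.
Proof.
apply/lfunP => x; apply: subvs_inj.
by rewrite comp_lfunE !vsval_sub_map -(pm_comp V h1 h2 h3) comp_lfunE.
Qed.

Definition sub_pmod : pmod T F := Pmod sub_map_id sub_map_comp.
End Submodule.

Section Splitting.
Context {d : Order.disp_t} {T : porderType d} {F : fieldType}.
Variables (V : pmod T F) (S : pred T) (cS : convex_pred S).
Variables (x : forall s, V s) (phi : forall s, 'Hom(V s, F^o)).
Hypothesis x_out : forall s, ~~ S s -> x s = 0.
Hypothesis phi_out : forall s, ~~ S s -> phi s = 0.
Hypothesis phi_x : forall s, S s -> phi s (x s) = 1.
Hypothesis map_x : forall s t (h : (s <= t)%O), S s -> pm_map V h (x s) = x t.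
Hypothesis phi_map : forall s t (h : (s <= t)%O) y,
  S t -> phi t (pm_map V h y) = phi s y.

Lemma ker_stable (s t : T) (h : (s <= t)%O) y :
  y \in lker (phi s) -> pm_map V h y \in lker (phi t).
Proof.
rewrite !memv_ker => /eqP y0; have [St|nSt] := boolP (S t).
  by rewrite phi_map // y0.
by rewrite phi_out // zero_lfunE.
Qed.

(** The two projections of the decomposition of [V] into the span of [x] and the kernel of [phi]. *)
Definition split_fun (s : T) (y : V s) :
    dsum_pmod (ind_pmod cS) (sub_pmod ker_stable) s :=
  (const_mx (phi s y : F), vsproj (lker (phi s)) (y - (phi s y : F) *: x s)).

Fact split_fun_linear (s : T) : linear (@split_fun s).
Proof.
move=> a y z; congr pair.
  by apply/matrixP => i j; rewrite !mxE linearP.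
have -> : a *: y + z - (phi s (a *: y + z) : F) *: x s
    = a *: (y - (phi s y : F) *: x s) + (z - (phi s z : F) *: x s).
  by rewrite linearP scalerDl scalerBr scalerA opprD addrACA.
exact: linearP.
Qed.

HB.instance Definition _ (s : T) :=
  GRing.isLinear.Build F (V s) (dsum_pmod (ind_pmod cS) (sub_pmod ker_stable) s)
    _ (@split_fun s) (@split_fun_linear s).

Lemma split_ker (s : T) (y : V s) :
  y - (phi s y : F) *: x s \in lker (phi s).
Proof.
rewrite memv_ker linearB linearZ /=; have [Ss|nSs] := boolP (S s).
  by rewrite phi_x // [_ *: _]mulr1 subrr.
by rewrite phi_out // !zero_lfunE scale0r subrr.
Qed.

Lemma split_iso : pm_iso V (dsum_pmod (ind_pmod cS) (sub_pmod ker_stable)).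
Proof.
(* A row of length [b] has one entry or none; the sum of its entries recovers the entry without
   naming an index. *)
have row0 (b : bool) (A B : 'rV[F]_b) : ~~ b -> A = B.
  by case: b A B => // A B _; rewrite [A]thinmx0 [B]thinmx0.
have row1 (b c : bool) (a : F) : b -> c ->
    const_mx a = (const_mx a : 'rV[F]_b) *m (pid_mx 1 : 'M[F]_(b, c)).
  by case: b c => [] [] // _ _; rewrite pid_mx_1 mulmx1.
have row2 (b : bool) (a : 'rV[F]_b) : b -> const_mx (\sum_j a 0 j) = a.
  by case: b a => // a _; apply/rowP => j; rewrite mxE big_ord1 (ord1 j).
have row3 (b : bool) (a : F) : b -> \sum_j (const_mx a : 'rV[F]_b) 0 j = a.
  by case: b => // _; rewrite big_ord1 mxE.
have splitE s y : linfun (@split_fun s) y = split_fun y by rewrite lfunE.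
exists (fun s => linfun (@split_fun s)).
  move=> s t h; apply/lfunP => y.
  rewrite [LHS]comp_lfunE [RHS]comp_lfunE (splitE t) (splitE s) [RHS]lfunE /=.
  rewrite /dsum_fun /=; congr pair.
    rewrite lfunE /=; have /orP[St|nSt] := orbN (S t); last exact: row0.
    rewrite phi_map //; have /orP[Ss|nSs] := orbN (S s); last first.
      rewrite phi_out // zero_lfunE; apply/matrixP => i j.
      by rewrite !mxE big1 // => k _; rewrite mxE mul0r.
    exact: row1.
  apply: subvs_inj; rewrite (vsval_sub_map ker_stable).
  apply: etrans (vsprojK (split_ker _)) _.
  apply: etrans (esym (congr1 _ (vsprojK (split_ker _)))).
  rewrite [RHS]linearB [in RHS]linearZ /=; congr (_ + - _).
  have /orP[Ss|nSs] := orbN (S s); last first.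
    rewrite (phi_out nSs) zero_lfunE scale0r.
    have /orP[St|nSt] := orbN (S t); last by rewrite x_out // scaler0.
    by rewrite phi_map // phi_out // zero_lfunE scale0r.
  rewrite map_x //; have /orP[St|nSt] := orbN (S t); last by rewrite x_out // !scaler0.
  by rewrite phi_map.
move=> s.
pose g (rw : dsum_pmod (ind_pmod cS) (sub_pmod ker_stable) s) : V s :=
  (\sum_j (rw.1 : 'rV[F]_(S s)) 0 j) *: x s + vsval rw.2.
exists g => [y|[r w]].
  rewrite splitE /g /= vsprojK ?split_ker //.
  have /orP[Ss|nSs] := orbN (S s); last by rewrite x_out // !scaler0 subr0 add0r.
  by rewrite row3 // addrC subrK.
have w0 : phi s (vsval w) = 0 by apply/eqP; rewrite -memv_ker subvsP.
have phiD c : S s -> phi s (c *: x s + vsval w) = c.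
  by move=> Ss; rewrite linearD linearZ /= phi_x // w0 addr0 [_ *: _]mulr1.
rewrite splitE /g /= /split_fun; congr pair.
  have /orP[Ss|nSs] := orbN (S s); last exact: row0.
  rewrite phiD //; exact: row2.
apply: subvs_inj; rewrite vsprojK ?split_ker //.
have /orP[Ss|nSs] := orbN (S s); last by rewrite x_out // !scaler0 subr0 add0r.
by rewrite phiD // addrC addKr.
Qed.

End Splitting.

(** * Interval decomposition of tame modules *)

Section Decomposition.
Context {R : realType} {F : fieldType}.
Implicit Types (V W : pmod R F) (bs : seq R) (D : seq (@dpoint R)).

(** The second clause makes the maps bijective when no breakpoint lies in [(s, t]], so the pieces of
    constancy are closed on the left, as the bars are. *)
Definition tame V bs : Prop :=
  (forall s, (forall b, b \in bs -> s < b) -> forall y : V s, y = 0) /\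
  (forall (s t : R) (h : (s <= t)%O),
     (forall b, b \in bs -> b <= t -> b <= s) ->
     injective (pm_map V h) /\ forall y, exists x, y = pm_map V h x).

Definition endpoints_in bs D : bool :=
  all (fun p : @dpoint R =>
         (p.1 \in bs) && ((p.2 == +oo%E) || (p.2 \in [seq b%:E | b <- bs]))) D.

(** The space at [s] is the image of the one at the last breakpoint up to [s]. *)
Lemma tame_eq0 V bs s :
  tame V bs -> (forall b, b \in bs -> b <= s -> forall y : V b, y = 0) ->
  forall y : V s, y = 0.
Proof.
move=> [V0 Viso] zero_below y.
have [/(seq_argmax id)[b [bbs bs_le bmax]]|no] := boolP (has (<=%R^~ s) bs).
  have [c cbs cs|_ /(_ y)[x ->]] := Viso b s bs_le; first exact: bmax.
  by rewrite (zero_below b bbs bs_le x) linear0.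
apply: V0 => b bbs; rewrite ltNge; apply: contra no => le_bs.
by apply/hasP; exists b.
Qed.

Lemma pm_map_comp V (s t r : R) (h1 : (s <= t)%O) (h2 : (t <= r)%O)
    (h3 : (s <= r)%O) x : pm_map V h2 (pm_map V h1 x) = pm_map V h3 x.
Proof. by rewrite -(pm_comp V h1 h2 h3) comp_lfunE. Qed.

Lemma pm_map_refl V (s : R) (h : (s <= s)%O) x : pm_map V h x = x.
Proof. by rewrite pm_id id_lfunE. Qed.

Lemma pm_rank_refl0 V s :
  pm_rank V (lexx s) = 0%N -> forall y : V s, y = 0.
Proof.
rewrite /pm_rank pm_id lim1g dimvf => d0 y; apply/eqP.
by rewrite -memv0 -(_ : fullv = 0%VS) ?memvf //; apply/eqP; rewrite -dimv_eq0 dimvf d0.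
Qed.

Lemma dual_vector (A : vectType F) (x : A) :
  x != 0 -> exists f : 'Hom(A, F^o), f x = 1.
Proof.
move=> x0; exists (linfun (coord [tuple x] ord0 : A -> F^o)); rewrite lfunE /=.
by have := coord_free (X := [tuple x]) ord0 ord0; rewrite /= seq1_free => ->.
Qed.

Lemma pm_iso_trans (U V W : pmod R F) : pm_iso U V -> pm_iso V W -> pm_iso U W.
Proof.
move=> [f fnat fbij] [g gnat gbij]; exists (fun u => (g u \o f u)%VF).
  by move=> s t h; rewrite -comp_lfunA fnat comp_lfunA gnat comp_lfunA.
move=> u; have [f' fK f'K] := fbij u; have [g' gK g'K] := gbij u.
by exists (f' \o g') => y; rewrite /= comp_lfunE ?gK // f'K.
Qed.

Section DirectSumRight.
Variables (U V W : pmod R F) (f : forall u, 'Hom(V u, W u)).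

Definition dsumr_fun u (x : dsum_pmod U V u) : dsum_pmod U W u := (x.1, f u x.2).

Fact dsumr_fun_linear u : linear (@dsumr_fun u).
Proof. by move=> a x y; congr pair; rewrite /= linearP. Qed.

HB.instance Definition _ u :=
  GRing.isLinear.Build F (dsum_pmod U V u) (dsum_pmod U W u) _ (@dsumr_fun u)
    (@dsumr_fun_linear u).

Lemma dsumr_funE u x : linfun (@dsumr_fun u) x = (x.1, f u x.2).
Proof. by rewrite lfunE. Qed.
End DirectSumRight.

Lemma pm_iso_dsumr (U V W : pmod R F) :
  pm_iso V W -> pm_iso (dsum_pmod U V) (dsum_pmod U W).
Proof.
move=> [f fnat fbij]; exists (fun u => linfun (@dsumr_fun U V W f u)).
  move=> s t h; apply/lfunP => x.
  rewrite [LHS]comp_lfunE [RHS]comp_lfunE !dsumr_funE [RHS]lfunE.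
  rewrite [pm_map _ _ _]lfunE /= /dsum_fun /=; congr pair.
  by rewrite -[LHS]comp_lfunE fnat comp_lfunE.
move=> u; have [f' fK f'K] := fbij u.
by exists (fun x => (x.1, f' x.2)) => -[x y]; rewrite dsumr_funE /= ?fK ?f'K.
Qed.

(* [x] is born at the first breakpoint [b0] with nonzero space and [e] is its
   last breakpoint alive; [phi] is a functional on [V e] transported to all of
   the lifetime of [x]. *)
Lemma split_off_bar V bs b0 :
  tame V bs -> b0 \in bs -> pm_rank V (lexx b0) != 0%N ->
  (forall b, b \in bs -> b < b0 -> pm_rank V (lexx b) = 0%N) ->
  exists (p : @dpoint R) (W : pmod R F),
    [/\ (p.1%:E < p.2)%E, endpoints_in bs [:: p], p.1 = b0, tame W bs &
        pm_iso V (dsum_pmod (interval_pmod p) W)].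
Proof.
move=> tV b0bs b0nz b0min; have [V0 Viso] := tV.
have [x0 x0nz] : exists x : V b0, x != 0.
  apply: contrapT => no; move: b0nz; rewrite /pm_rank pm_id lim1g => /negP; apply.
  rewrite dimv_eq0 -subv0; apply/subvP => x _; rewrite memv0.
  by apply: contrapT => /negP xnz; apply: no; exists x.
have below s : s < b0 -> forall y : V s, y = 0.
  move=> sb; apply: (tame_eq0 tV) => b bbs bs_le.
  by apply: pm_rank_refl0; apply: b0min => //; exact: le_lt_trans bs_le sb.
pose x s : V s := if boolP (b0 <= s) is AltTrue h then pm_map V h x0 else 0.
have xE s (h : (b0 <= s)%O) : x s = pm_map V h x0.
  rewrite /x; case: {-}_ / boolP => [h'|/negP//].
  by congr (pm_map V _ x0); exact: eq_irrelevance.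
have x_lt s : s < b0 -> x s = 0 by move=> /below.
have map_x s t (h : (s <= t)%O) : b0 <= s -> pm_map V h (x s) = x t.
  move=> bs_le; rewrite xE (xE t (le_trans bs_le h)).
  by rewrite (pm_map_comp _ _ (le_trans bs_le h)).
have x0E : x b0 = x0 by rewrite (xE b0 (lexx b0)) pm_map_refl.
(* The death is the first breakpoint from [b0] on where [x] vanishes, infinite if there is none.
   Between breakpoints [x] cannot start to vanish, as the maps are injective. *)
have [d [d_gt d_in dP]] : exists d : \bar R, [/\ (b0%:E < d)%E,
    (d == +oo%E) || (d \in [seq b%:E | b <- bs]) &
    forall s, b0 <= s -> (s%:E < d)%E = (x s != 0)].
  have [hasd|nod] := boolP (has (fun b => (b0 <= b) && (x b == 0)) bs).
    have [c [cbs /andP[b0c /eqP xc] cmin]] := seq_argmin id hasd.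
    exists c%:E; split.
    - rewrite lte_fin lt_neqAle b0c andbT; apply: contra x0nz => /eqP b0E.
      by rewrite -x0E; apply/eqP; move: xc; rewrite -b0E.
    - by rewrite map_f ?orbT.
    - move=> s b0s; rewrite lte_fin ltNge; congr (~~ _); apply/idP/eqP => [cs|xs].
        by rewrite -(map_x c s cs b0c) xc linear0.
      have hasb : has (fun b => b <= s) bs by apply/hasP; exists b0.
      have [b [bbs bs_le bmax]] := seq_argmax id hasb.
      have b0b : b0 <= b by exact: bmax.
      have [c' c'bs c's|binj _] := Viso b s bs_le; first exact: bmax.
      apply: (le_trans _ bs_le); apply: cmin => //; rewrite b0b; apply/eqP.
      by apply: binj; rewrite map_x // xs linear0.
  exists +oo%E; split=> [|//|s b0s]; first exact: ltry.
  rewrite ltry; symmetry; apply/negP => /eqP xs.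
  have hasb : has (fun b => b <= s) bs by apply/hasP; exists b0.
  have [b [bbs bs_le bmax]] := seq_argmax id hasb.
  have b0b : b0 <= b by exact: bmax.
  have [c' c'bs c's|binj _] := Viso b s bs_le; first exact: bmax.
  case/hasP: nod; exists b => //; rewrite b0b; apply/eqP.
  by apply: binj; rewrite map_x // xs linear0.
pose p : @dpoint R := (b0, d); pose S := in_bar p.
have SP s : S s = (b0 <= s) && (x s != 0).
  by rewrite /S /in_bar /=; case: (boolP (b0 <= s)) => //= /dP.
have Sb0 : S b0 by rewrite SP lexx x0E.
have hasS : has S bs by apply/hasP; exists b0.
have [e [ebs Se emax]] := seq_argmax id hasS.
have b0e : b0 <= e by case/andP: Se.
have [phi0 phi0x] : exists f : 'Hom(V e, F^o), f (x e) = 1.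
  by apply: dual_vector; move: Se; rewrite SP => /andP[].
have iso_e s (h : (e <= s)%O) :
    S s -> injective (pm_map V h) /\ forall y, exists x, y = pm_map V h x.
  move=> Ss; apply: Viso => c cbs cs; rewrite leNgt; apply/negP => ec.
  have Sc : S c by exact: (@convex_bar _ p e c s (ltW ec) cs).
  by move: ec; rewrite ltNge emax.
(* Before [e] the functional [phi0] is pulled back. After [e] no breakpoint is left inside the bar,
   so the map from [e] is invertible and [phi0] is carried along by its inverse. *)
have phi_ex s : exists f : 'Hom(V s, F^o),
    [/\ ~~ S s -> f = 0,
      forall h : (s <= e)%O, S s -> forall y, f y = phi0 (pm_map V h y) &
      forall h : (e <= s)%O, S s -> forall y, f (pm_map V h y) = phi0 y].
  have [Ss|nSs] := boolP (S s); last by exists 0.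
  have /orP[lt_es|le_se] := orNb (s <= e); first rewrite -ltNge in lt_es.
    have [inj surj] := iso_e s (ltW lt_es) Ss.
    exists (phi0 \o (pm_map V (ltW lt_es))^-1)%VF; split=> // h.
      by have := le_lt_trans h lt_es; rewrite ltxx.
    rewrite (eq_irrelevance h (ltW lt_es)) => _ y.
    by rewrite comp_lfunE lker0_lfunK //; exact/lker0P.
  exists (phi0 \o pm_map V le_se)%VF; split=> // h _ y.
    by rewrite comp_lfunE (eq_irrelevance h le_se).
  by rewrite comp_lfunE (pm_map_comp h le_se (lexx e)) pm_map_refl.
pose phi s := projT1 (cid (phi_ex s)).
have phiP s := projT2 (cid (phi_ex s)).
have phi_out s : ~~ S s -> phi s = 0 by case: (phiP s).
have phi_x s : S s -> phi s (x s) = 1.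
  move=> Ss; have [_ phi_le phi_ge] := phiP s.
  have b0s : b0 <= s by case/andP: Ss.
  have /orP[le_se|le_es] := le_total s e.
    by rewrite [phi s _](phi_le le_se Ss) map_x.
  by rewrite -(map_x e s le_es b0e) [phi s _](phi_ge le_es Ss).
have map_xS s t (h : (s <= t)%O) : S s -> pm_map V h (x s) = x t.
  by case/andP=> b0s _; exact: map_x.
have x_out s : ~~ S s -> x s = 0.
  rewrite SP negb_and -ltNge negbK => /orP[/x_lt//|/eqP//].
(* If the bar contains [t] but not [s], then [s] precedes the birth and [V s] is zero. *)
have phi_map s t (h : (s <= t)%O) y : S t -> phi t (pm_map V h y) = phi s y.
  move=> St; have /orP[Ss|nSs] := orbN (S s); last first.
    have y0 : y = 0.
      apply: below; rewrite ltNge; apply: contra nSs => b0s.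
      apply/andP; split=> //; apply: le_lt_trans (proj2 (andP St)).
      by rewrite lee_fin.
    by rewrite y0 !linear0.
  have [_ phis_le phis_ge] := phiP s; have [_ phit_le phit_ge] := phiP t.
  have /orP[le_te|le_et] := le_total t e.
    rewrite [LHS](phit_le le_te St) [RHS](phis_le (le_trans h le_te) Ss).
    by rewrite (pm_map_comp _ _ (le_trans h le_te)).
  have /orP[le_se|le_es] := le_total s e.
    rewrite [RHS](phis_le le_se Ss) -(pm_map_comp le_se le_et h).
    exact: phit_ge.
  have [_ /(_ y)[z ->]] := iso_e s le_es Ss.
  rewrite (pm_map_comp le_es h le_et) [LHS](phit_ge le_et St).
  by rewrite [RHS](phis_ge le_es Ss).
exists p, (sub_pmod (ker_stable phi_out phi_map)); split=> //.
- by rewrite /endpoints_in /= b0bs d_in.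
- split=> [s s_lt y|s t h noc].
    by apply: subvs_inj; rewrite (V0 s s_lt (vsval y)) linear0.
  have [inj surj] := Viso s t h noc; split=> [y z yz|y].
    apply/subvs_inj/inj; rewrite -!(vsval_sub_map (ker_stable phi_out phi_map)).
    exact: congr1 yz.
  have [z yz] := surj (vsval y).
  (* If [t] is outside the bar, so is [s]: a death in [(s, t]] would be a breakpoint there. *)
  have zker : z \in lker (phi s).
    rewrite memv_ker; have /orP[St|nSt] := orbN (S t).
      by rewrite -(phi_map s t h) // -yz -memv_ker subvsP.
    rewrite phi_out ?zero_lfunE //; apply: contra nSt => /andP[/= b0s sd].
    apply/andP; split; first exact: (le_trans _ h).
    case/orP: d_in => [/eqP dE|/mapP[c cbs dE]].
      by rewrite /= dE ltry.
    rewrite /= dE lte_fin ltNge; move: sd; rewrite dE lte_fin ltNge.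
    by apply: contra => /(noc c cbs).
  exists (Subvs zker); apply: subvs_inj.
  by rewrite (vsval_sub_map (ker_stable phi_out phi_map)).
- exact: (split_iso (convex_bar (p := p)) x_out phi_out phi_x map_xS).
Qed.

(** Bars are split off one at a time; the total dimension at the breakpoints drops, since each bar
    contains its birth, which is a breakpoint. *)
Lemma tame_dgm V bs :
  tame V bs -> exists2 D, is_dgm V D & endpoints_in bs D.
Proof.
have [n] := ubnP (\sum_(b <- bs) pm_rank V (lexx b)); elim: n V => // n IH V le_n tV.
have [hasb|allz] := boolP (has (fun b => pm_rank V (lexx b) != 0%N) bs); last first.
  have zV s (y : V s) : y = 0.
    apply: (tame_eq0 tV) => b bbs _; apply: pm_rank_refl0; apply/eqP.
    by apply: contraNT allz => bnz; apply/hasP; exists b.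
  exists [::] => //; split=> //; exists (fun s => 0) => [s t h|s].
    by rewrite comp_lfun0r comp_lfun0l.
  exists (fun=> 0) => y; first by rewrite [RHS]zV.
  by rewrite [y]thinmx0 zero_lfunE.
have [b0 [b0bs b0nz b0min]] := seq_argmin id hasb.
have [|p [W [p_lt p_in p1 tW isoVW]]] := split_off_bar tV b0bs b0nz.
  move=> b bbs lt_b; apply/eqP; apply: contraTT lt_b => bnz.
  by rewrite -leNgt; exact: b0min.
have rkE b : pm_rank V (lexx b) = (in_bar p b + pm_rank W (lexx b))%N.
  by rewrite (pm_rank_iso _ isoVW) pm_rank_dsum pm_rank_ind andbb.
have [|D [D_lt isoWD] D_in] := IH W _ tW.
  apply: leq_trans (_ : (_ <= \sum_(b <- bs) pm_rank V (lexx b))%N) _ => //.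
  rewrite (eq_bigr _ (fun b _ => rkE b)) big_split /= -add1n leq_add2r.
  rewrite (big_rem b0) //= /in_bar p1 lexx /=.
  by move: p_lt; rewrite p1 => ->.
exists (p :: D); last by move: p_in; rewrite /endpoints_in /= andbT => ->.
split; first by rewrite /= p_lt.
exact: pm_iso_trans isoVW (pm_iso_dsumr _ isoWD).
Qed.

End Decomposition.

(** * Bottleneck distance and uniqueness of diagrams *)

Section BottleneckRelation.
Context {R : realType}.
Implicit Types (D E : seq (@dpoint R)) (e : \bar R).

(** Matchings of cost at most [e] in a form insensitive to the order of the points: the pairs, then
    the unmatched points of either side. *)
Definition matched e D E : Prop :=
  exists (ps : seq (@dpoint R * @dpoint R)) (du eu : seq (@dpoint R)),
    [/\ perm_eq D ([seq x.1 | x <- ps] ++ du),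
        perm_eq E ([seq x.2 | x <- ps] ++ eu),
        {in ps, forall x, dpoint_dist x.1 x.2 <= e}%E,
        {in du, forall x, half_pers x <= e}%E &
        {in eu, forall x, half_pers x <= e}%E].

Lemma bottleneck_attained D E :
  exists2 s, is_matching s & bottleneck D E = matching_cost (D := D) (E := E) s.
Proof.
have [||s ms sE] := @eq_bigmin _ (\bar R) _ +oo%E [ffun=> None]
    (@is_matching R D E) (@matching_cost R D E); last by exists s.
(* The empty matching shows that the minimum is taken over a nonempty family. *)
- by apply/forallP => i; apply/forallP => j; rewrite !ffunE.
- by move=> s _; exact: leey.
Qed.

Lemma bottleneck_ge0 D E : (0 <= bottleneck D E)%E.
Proof.
have [s _ ->] := bottleneck_attained D E.
by rewrite /matching_cost le_max; apply/orP; left; exact: bigmax_ge_id.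
Qed.

Lemma bottleneck_matched D E : matched (bottleneck D E) D E.
Proof.
have [s /forallP sm ->] := bottleneck_attained D E.
pose dD := tnth (in_tuple D); pose dE := tnth (in_tuple E).
have mapD : [seq dD i | i <- enum 'I_(size D)] = D.
  exact: map_tnth_enum (in_tuple D).
have mapE : [seq dE i | i <- enum 'I_(size E)] = E.
  exact: map_tnth_enum (in_tuple E).
have sinj i j : s i != None -> s i = s j -> i = j.
  move=> si sij; apply/eqP; have /forallP/(_ j)/implyP := sm i; apply.
  by rewrite si sij eqxx.
pose ms := [seq i <- enum 'I_(size D) | s i != None].
pose hit j := ~~ [forall i, s i != Some j].
have cD i : (match s i with Some j => dpoint_dist (dD i) (dE j)
              | None => half_pers (dD i) end <= matching_cost s)%E.
  rewrite /matching_cost le_max; apply/orP; left.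
  exact: (le_bigmax _ (fun i => match s i with
    | Some j => dpoint_dist (dD i) (dE j) | None => half_pers (dD i) end)).
exists [seq (dD i, oapp dE (0, 0%E) (s i)) | i <- ms],
  [seq dD i | i <- enum 'I_(size D) & s i == None],
  [seq dE j | j <- enum 'I_(size E) & ~~ hit j].
split.
- rewrite -{1}mapD -map_comp /= -map_cat perm_map // perm_sym.
  rewrite (@eq_filter _ (fun i => s i == None) (predC (fun i => s i != None))).
    by rewrite perm_filterC.
  by move=> i /=; rewrite negbK.
- pose J := enum 'I_(size E); rewrite -{1}mapE -!/J.
  apply: (@perm_trans _
    [seq dE j | j <- [seq j <- J | hit j] ++ [seq j <- J | ~~ hit j]]).
    by rewrite perm_map // perm_sym perm_filterC.
  rewrite map_cat perm_cat2r.
  rewrite -map_comp; set h := oapp dE (0, 0%E).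
  have -> : [seq dE j | j <- J & hit j] = map h (map some [seq j <- J | hit j]).
    by rewrite -map_comp.
  rewrite (_ : [seq _ | i <- ms] = map h (map s ms)) ?perm_map //; last first.
    by rewrite -map_comp.
  (* Injectivity of [s] makes the list of images duplicate free, so it suffices to compare
     members. *)
  apply: uniq_perm.
  + rewrite map_inj_uniq => [|i j []//].
    exact/filter_uniq/enum_uniq.
  + rewrite map_inj_in_uniq; first exact/filter_uniq/enum_uniq.
    by move=> i j; rewrite mem_filter => /andP[si _] _; exact: sinj.
  move=> o; apply/mapP/mapP => [[j]|[i]]; rewrite mem_filter.
    move=> /andP[/forallPn[i] /negbNE/eqP sij _] ->; exists i => //.
    by rewrite mem_filter sij mem_enum.
  case/andP=> si _ ->; case sij: (s i) si => [j|//] _; exists j => //.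
  rewrite mem_filter mem_enum andbT; apply/forallPn; exists i.
  by rewrite sij eqxx.
- move=> _ /mapP[i + ->] /=; rewrite mem_filter => /andP[+ _].
  by have := cD i; case: (s i).
- move=> _ /mapP[i + ->] /=; rewrite mem_filter => /andP[+ _].
  by have := cD i; case: (s i).
- move=> _ /mapP[j + ->] /=; rewrite mem_filter negbK => /andP[jP _].
  rewrite /matching_cost le_max; apply/orP; right.
  exact: (@le_bigmax_cond _ _ _ _ _ (fun j => [forall i, s i != Some j])
    (fun j => half_pers (dE j))).
Qed.

Lemma matched_bottleneck e D E :
  (0 <= e)%E -> matched e D E -> (bottleneck D E <= e)%E.
Proof.
move=> e0 [ps [du [eu [pD pE cps cdu ceu]]]].
pose x0 : @dpoint R := (0, 0%E).
rewrite perm_sym in pD; rewrite perm_sym in pE.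
have /(perm_iotaP x0)[Is pIs DE] := pD.
have /(perm_iotaP x0)[Js pJs EE] := pE.
have uI : uniq Is by rewrite (perm_uniq pIs) iota_uniq.
have uJ : uniq Js by rewrite (perm_uniq pJs) iota_uniq.
have memI i : (i \in Is) = (i < size D)%N by rewrite (perm_mem pIs) mem_iota.
have memJ j : (j \in Js) = (j < size E)%N by rewrite (perm_mem pJs) mem_iota.
have szI : size Is = (size ps + size du)%N.
  by have := congr1 size DE; rewrite size_cat !size_map.
have szJ : size Js = (size ps + size eu)%N.
  by have := congr1 size EE; rewrite size_cat !size_map.
(* [Is] and [Js] list the indices of [D] and [E] in the order of the pairs followed by the
   leftovers; indices at the same position below [size ps] are matched. *)
pose s : {ffun 'I_(size D) -> option 'I_(size E)} :=
  [ffun i : 'I_(size D) => if (index (val i) Is < size ps)%N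
    then insub (nth 0%N Js (index (val i) Is)) else None].
have sE (i : 'I_(size D)) (j : 'I_(size E)) : s i = Some j ->
    (index (val i) Is < size ps)%N /\ val j = nth 0%N Js (index (val i) Is).
  by rewrite ffunE; case: ifP => // lti; case: insubP => // k _ kE [<-].
have sN (i : 'I_(size D)) : s i = None -> (size ps <= index (val i) Is)%N.
  rewrite ffunE; case: ltnP => // lti; case: insubP => //.
  by rewrite -memJ mem_nth // szJ ltn_addr.
have nthI (i : 'I_(size D)) : nth x0 D i =
    nth x0 ([seq x.1 | x <- ps] ++ du) (index (val i) Is).
  by rewrite DE (nth_map 0%N) ?index_mem ?memI ?ltn_ord // nth_index ?memI // ltn_ord.
have nthJ (j : 'I_(size E)) : nth x0 E j =
    nth x0 ([seq x.2 | x <- ps] ++ eu) (index (val j) Js).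
  by rewrite EE (nth_map 0%N) ?index_mem ?memJ ?ltn_ord // nth_index ?memJ // ltn_ord.
apply: (@bigmin_inf _ _ _ _ s).
  apply/forallP => i; apply/forallP => j; apply/implyP => /andP[].
  case si: (s i) => [k|//] _ /eqP/esym sj.
  have [lti ki] := sE _ _ si; have [ltj kj] := sE _ _ sj.
  apply/eqP/val_inj.
  have iI : val i \in Is by rewrite memI ltn_ord.
  have jI : val j \in Is by rewrite memI ltn_ord.
  apply: etrans (esym (nth_index 0%N iI)) (etrans _ (nth_index 0%N jI)).
  congr (nth 0%N Is _); apply/eqP.
  by rewrite -(nth_uniq 0%N _ _ uJ) ?szJ ?ltn_addr // -ki kj.
rewrite /matching_cost ge_max; apply/andP; split.
  apply/bigmax_leP; split=> // i _; rewrite !(tnth_nth x0) /=.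
  case si: (s i) => [j|]; last first.
    apply: cdu; rewrite nthI nth_cat size_map ltnNge sN //=.
    rewrite mem_nth // -(ltn_add2l (size ps)) subnKC ?sN // -szI.
    by rewrite index_mem memI ltn_ord.
  have [lti ji] := sE _ _ si; rewrite (tnth_nth x0) /= nthI nthJ ji.
  rewrite index_uniq ?szJ ?ltn_addr // !nth_cat !size_map lti.
  by rewrite !(nth_map (x0, x0)) // cps // mem_nth.
apply/bigmax_leP; split=> // j /forallP noj; rewrite (tnth_nth x0) /=.
apply: ceu; rewrite nthJ nth_cat size_map; have [ltj|gej] := ltnP.
  have ltI : (index (val j) Js < size Is)%N by rewrite szI ltn_addr.
  have ltD : (nth 0%N Is (index (val j) Js) < size D)%N by rewrite -memI mem_nth.
  have := noj (Ordinal ltD).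
  rewrite ffunE /= index_uniq // ltj nth_index ?memJ ?ltn_ord //.
  by rewrite valK eqxx.
by rewrite mem_nth // -(ltn_add2l (size ps)) subnKC // -szJ index_mem memJ ltn_ord.
Qed.

End BottleneckRelation.

Section DiagramUniqueness.
Context {R : realType}.
Implicit Types (D E : seq (@dpoint R)) (p q : @dpoint R).

Definition nondeg p : bool := (p.1%:E < p.2)%E.

Definition same_counts D E : Prop :=
  forall s t : R, s <= t -> count (alive s t) D = count (alive s t) E.

Lemma has_alive D E (s t : R) p :
  same_counts D E -> s <= t -> p \in D -> alive s t p ->
  exists2 q, q \in E & alive s t q.
Proof.
move=> DE st pD pst; apply/hasP; rewrite has_count -DE // -has_count.
by apply/hasP; exists p.
Qed.

Lemma min_birth_le D E p q :
  same_counts D E -> p \in D -> nondeg p ->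
  (forall y, y \in E -> q.1 <= y.1) -> q.1 <= p.1.
Proof.
move=> DE pD pnd qmin.
have [|y yE /andP[yp _]] := has_alive DE (lexx p.1) pD; first by rewrite /alive lexx.
exact: le_trans (qmin y yE) yp.
Qed.

Lemma max_death_le D E p q :
  same_counts D E -> p \in D -> nondeg p -> nondeg q ->
  (forall y, y \in E -> p.1 <= y.1) ->
  (forall y, y \in E -> y.1 == p.1 -> y.2 <= q.2)%E -> (p.2 <= q.2)%E.
Proof.
move=> DE pD pnd qnd pmin qmax; rewrite leNgt; apply/negP => qp.
have q2E : q.2 = (fine q.2)%:E.
  by rewrite /nondeg in qnd; case: (q.2) qp qnd => [r| |] //; rewrite ltNge leey.
(* At [t] the bar [p] is still alive, whereas the bars of [E] born up to [p.1] are born at [p.1] and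
   have died with [q] at the latest. The maximum ensures [p.1 <= t], as [same_counts] requires. *)
pose t := Num.max (fine q.2) p.1.
have pt : p.1 <= t by rewrite le_max lexx orbT.
have tp : (t%:E < p.2)%E.
  by rewrite /t maxEle; case: ifP => _ //; rewrite -q2E.
have [|y yE /andP[yp ty]] := has_alive DE pt pD; first by rewrite /alive lexx.
have yq : (y.2 <= q.2)%E by apply: qmax => //; rewrite eq_le yp pmin.
by have := lt_le_trans ty yq; rewrite q2E lte_fin ltNge le_max lexx.
Qed.

(* Among the points with minimal birth take one with maximal death. *)
Lemma same_counts_common D E :
  all nondeg D -> all nondeg E -> same_counts D E -> D != [::] ->
  exists p, p \in D /\ p \in E.
Proof.
move=> /allP Dnd /allP End DE Dn0; have ED : same_counts E D by move=> s t /DE.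
have hasD : has predT D by rewrite has_predT -size_eq0 lt0n in Dn0 *.
have [p [pD _ pmin]] := seq_argmin (fun x : @dpoint R => x.1) hasD.
have hasE : has predT E.
  have [|q qE _] := has_alive DE (lexx p.1) pD; last by apply/hasP; exists q.
  by rewrite /alive lexx; exact: Dnd.
have [q [qE _ qmin]] := seq_argmin (fun x : @dpoint R => x.1) hasE.
have pq : p.1 = q.1.
  apply/eqP; rewrite eq_le (min_birth_le ED qE (End q qE)) => [|y yD]; last exact: pmin.
  by rewrite (min_birth_le DE pD (Dnd p pD)) // => y yE; exact: qmin.
have [|a [aD /eqP a1 amax]] := @seq_argmax _ _ _ (fun x : @dpoint R => x.2)
  (fun x => x.1 == p.1) D; first by apply/hasP; exists p.
have [|b [bE /eqP b1 bmax]] := @seq_argmax _ _ _ (fun x : @dpoint R => x.2)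
  (fun x => x.1 == p.1) E; first by apply/hasP; exists q => //; rewrite pq.
exists a; split=> //; suff -> : a = b by [].
rewrite [a]surjective_pairing [b]surjective_pairing a1 b1; congr pair.
apply/eqP; rewrite eq_le; apply/andP; split.
  apply: (max_death_le DE aD (Dnd a aD) (End b bE)) => y yE.
    by rewrite a1 pq; exact: qmin.
  by rewrite a1; exact: bmax.
apply: (max_death_le ED bE (End b bE) (Dnd a aD)) => y yD.
  by rewrite b1; exact: pmin.
by rewrite b1; exact: amax.
Qed.

(** Removing a common point lowers all counts of both diagrams equally, which allows induction. *)
Lemma same_counts_perm D E :
  all nondeg D -> all nondeg E -> same_counts D E -> perm_eq D E.
Proof.
have [n] := ubnP (size D); elim: n D E => // n IH D E le_n Dnd End DE.
have [D0|Dn0] := eqVneq D [::].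
  have [->|En0] := eqVneq E [::]; first by rewrite D0.
  have [|p [_]] := same_counts_common End Dnd _ En0; first by move=> s t /DE.
  by rewrite D0.
have [p [pD pE]] := same_counts_common Dnd End DE Dn0.
rewrite (permPl (perm_to_rem pD)) (permPr (perm_to_rem pE)) perm_cons.
apply: IH => [||| s t st].
- by rewrite size_rem // prednK // lt0n size_eq0.
- by apply/allP => x /mem_rem/(allP Dnd).
- by apply/allP => x /mem_rem/(allP End).
have := DE s t st; rewrite (permP (perm_to_rem pD)) (permP (perm_to_rem pE)).
by move=> /= /addnI.
Qed.

Lemma matched_perm e D D' E E' :
  perm_eq D D' -> perm_eq E E' -> matched e D E -> matched e D' E'.
Proof.
move=> pD pE [ps [du [eu [h1 h2 h3 h4 h5]]]]; exists ps, du, eu; split=> //.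
  by rewrite -(permPl pD).
by rewrite -(permPl pE).
Qed.

Lemma matched_sym e D E : matched e D E -> matched e E D.
Proof.
have deathC (x y : \bar R) : death_dist x y = death_dist y x.
  rewrite /death_dist eq_sym; case: ifP => // _.
  by case: x y => [r| |] [r'| |] //=; congr (_%:E); exact: distrC.
have distC (p q : @dpoint R) : dpoint_dist p q = dpoint_dist q p.
  by rewrite /dpoint_dist distrC deathC.
move=> [ps [du [eu [h1 h2 h3 h4 h5]]]].
exists [seq (x.2, x.1) | x <- ps], eu, du; split=> //; rewrite -?map_comp //.
by move=> _ /mapP[x xps ->] /=; rewrite distC; exact: h3.
Qed.

Definition weak p : bool := (p.1%:E <= p.2)%E.

(* A point matched to the diagonal can be left unmatched at no cost. *)
Lemma half_pers_diag e p q :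
  weak p -> ~~ nondeg p -> (dpoint_dist p q <= e)%E -> (half_pers q <= e)%E.
Proof.
rewrite /weak /nondeg -leNgt => p1 p2; rewrite /dpoint_dist ge_max.
have -> : p.2 = p.1%:E by apply/eqP; rewrite eq_le p1 p2.
rewrite /half_pers /death_dist; case: q => q1 [q2| |] /=.
- rewrite eqe; case: e => [e| |] /=; last 2 first.
  + by move=> _; exact: leey.
  + by rewrite leeNy_eq.
  rewrite -EFinB -EFinM !lee_fin.
  have -> : (if p.1 == q2 then 0%E else `|p.1%:E - q2%:E|%E) = `|p.1 - q2|%:E.
    by case: (p.1 =P q2) => [->|_]; rewrite ?subrr ?normr0.
  rewrite lee_fin !ler_norml => /andP[/andP[h1 h2] /andP[h3 h4]].
  by lra.
- by rewrite leye_eq => /andP[_ /eqP->]; exact: leey.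
- by rewrite /= mulNyr gtr0_sg ?invr_gt0 // mul1e leNye.
Qed.

(** The partners of the removed diagonal points join the unmatched points. *)
Lemma matched_nondeg e D E :
  all weak D -> matched e D E -> matched e [seq p <- D | nondeg p] E.
Proof.
move=> /allP Dw [ps [du [eu [h1 h2 h3 h4 h5]]]].
pose a (x : @dpoint R * @dpoint R) := nondeg x.1.
exists [seq x <- ps | a x], [seq p <- du | nondeg p],
  ([seq x.2 | x <- ps & ~~ a x] ++ eu); split.
- have := perm_filter nondeg h1; rewrite filter_cat filter_map.
  exact.
- rewrite (permPl h2) catA perm_cat2r -map_cat perm_map // perm_sym.
  by rewrite perm_filterC.
- by move=> x; rewrite mem_filter => /andP[_ /h3].
- by move=> x; rewrite mem_filter => /andP[_ /h4].
move=> x; rewrite mem_cat => /orP[/mapP[y]|/h5//].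
rewrite mem_filter => /andP[ya yps] ->; apply: half_pers_diag (h3 y yps) => //.
by apply: Dw; rewrite (perm_mem h1) mem_cat map_f.
Qed.

Lemma matched_add_deg e D E :
  (0 <= e)%E -> all weak D -> matched e [seq p <- D | nondeg p] E ->
  matched e D E.
Proof.
move=> e0 /allP Dw [ps [du [eu [h1 h2 h3 h4 h5]]]].
exists ps, (du ++ [seq p <- D | ~~ nondeg p]), eu; split=> //.
  rewrite catA perm_sym -(permPl (perm_cat h1 (perm_refl _))).
  by rewrite perm_filterC.
move=> p; rewrite mem_cat => /orP[/h4//|].
rewrite mem_filter /nondeg -leNgt => /andP[p2 /Dw p1].
apply: le_trans e0; rewrite /half_pers.
have -> : p.2 = p.1%:E by apply/eqP; rewrite eq_le p2.
by rewrite subee // mul0e.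
Qed.

Lemma same_counts_nondeg D :
  same_counts D [seq p <- D | nondeg p].
Proof.
move=> s t st; rewrite count_filter; apply: eq_count => p /=.
rewrite /alive /nondeg; case: (boolP (p.1 <= s)) => //= ps.
case: (boolP (t%:E < p.2)%E) => //= tp; symmetry.
by apply: le_lt_trans tp; rewrite lee_fin (le_trans ps).
Qed.

(** A matching of [D] and [E] is stripped of diagonal points, carried over by a permutation to the
    points of [D'] and [E'] off the diagonal, and completed by the diagonal points of these at no
    cost. *)
Lemma le_bottleneck_same_counts D D' E E' :
  all weak D -> all weak D' -> all weak E -> all weak E' ->
  same_counts D D' -> same_counts E E' ->
  (bottleneck D' E' <= bottleneck D E)%E.
Proof.
move=> Dw Dw' Ew Ew' DD EE; have e0 := bottleneck_ge0 D E.
have perm A A' : same_counts A A' ->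
    perm_eq [seq p <- A | nondeg p] [seq p <- A' | nondeg p].
  move=> AA; apply: same_counts_perm; rewrite ?filter_all // => s t st.
  by rewrite -!same_counts_nondeg ?AA.
apply: (matched_bottleneck e0); apply: (matched_add_deg e0 Dw').
apply: matched_sym; apply: (matched_add_deg e0 Ew'); apply: matched_sym.
apply: matched_perm (perm _ _ DD) (perm _ _ EE) _.
apply: matched_nondeg => //; apply: matched_sym; apply: matched_nondeg => //.
by apply: matched_sym; exact: bottleneck_matched.
Qed.

Lemma bottleneck_same_counts D D' E E' :
  all weak D -> all weak D' -> all weak E -> all weak E' ->
  same_counts D D' -> same_counts E E' ->
  bottleneck D' E' = bottleneck D E.
Proof.
move=> Dw Dw' Ew Ew' DD EE; apply/eqP; rewrite eq_le.
by rewrite !le_bottleneck_same_counts // => s t st; rewrite ?DD ?EE.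
Qed.

End DiagramUniqueness.

(** Different names may have equal values, so a permutation of values has to be lifted to one of
    names. *)
Lemma perm_map_lift {A B : eqType} (f : A -> B) (s : seq A) (t : seq B) :
  perm_eq (map f s) t -> exists2 s', perm_eq s s' & t = map f s'.
Proof.
case: s => [|a s]; first by rewrite perm_sym => /perm_nilP->; exists [::].
rewrite perm_sym => /(perm_iotaP (f a))[Is pIs ->]; rewrite size_map in pIs.
exists (map (nth a (a :: s)) Is).
  by rewrite perm_sym; apply/(perm_iotaP a); exists Is.
rewrite -map_comp; apply/eq_in_map => i; rewrite (perm_mem pIs) mem_iota => /= li.
by rewrite -[f a :: _]/(map f (a :: s)) (nth_map a).
Qed.

(** * Diagrams named by critical values *)

Section Templates.
Context {R : realType} {A : eqType}.
Implicit Types (p q : A -> R) (T : seq (A * option A)) (S : seq A).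
Implicit Types (t : A * A * nat) (c : A * A * nat -> Prop).

(* A template is a diagram whose points are named by critical values, [None]
   being an infinite death; [p] evaluates the names along a line. *)
Definition tev p (x : A * option A) : @dpoint R :=
  (p x.1, if x.2 is Some v then (p v)%:E else +oo%E).

Definition tdgm p T : seq (@dpoint R) := [seq tev p x | x <- T].

(** With [d = 1] a triple [(u, v, d)] measures a difference of births or of deaths, with [d = 2]
    half the length of a bar. Property (Q) compares exactly these numbers. *)
Definition cost p t : R := `|p t.1.1 - p t.1.2| / t.2%:R.

Definition triple_of S t : bool :=
  [&& t.1.1 \in S, t.1.2 \in S & t.2 \in [:: 1; 2]%N].

Definition triples S : seq (A * A * nat) :=
  [seq (x, d) | x <- [seq (u, v) | u <- S, v <- S], d <- [:: 1; 2]%N].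

Lemma mem_triples S t : (t \in triples S) = triple_of S t.
Proof.
case: t => [[u v] d]; apply/allpairsP/and3P => /= [[[[u' v'] d'] /=]|[uS vS dS]].
  by move=> [/allpairsP[[a b] /= [aS bS [-> ->]]] dS [-> -> ->]].
exists ((u, v), d); split=> //; apply/allpairsP; exists (u, v); split=> //.
Qed.

Lemma cost_ge0 p t : 0 <= cost p t.
Proof. by rewrite /cost divr_ge0. Qed.

Lemma cost_diag p (u : A) d : cost p (u, u, d) = 0.
Proof. by rewrite /cost subrr normr0 mul0r. Qed.

Definition template_in S T : Prop :=
  {in T, forall x, x.1 \in S /\ forall v, x.2 = Some v -> v \in S}.

(** A matching of the names alone, where [c] tells which triples are cheap enough; it can be
    evaluated along different lines. *)
Definition tmatched c T T' : Prop :=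
  exists (ps : seq ((A * option A) * (A * option A))) (du eu : seq (A * option A)),
    [/\ perm_eq T ([seq x.1 | x <- ps] ++ du),
        perm_eq T' ([seq x.2 | x <- ps] ++ eu),
        {in ps, forall x, c (x.1.1, x.2.1, 1%N) /\
           match x.1.2, x.2.2 with
           | Some v, Some v' => c (v, v', 1%N)
           | None, None => True
           | _, _ => False
           end},
        {in du, forall x, if x.2 is Some v then c (x.1, v, 2%N) else False} &
        {in eu, forall x, if x.2 is Some v then c (x.1, v, 2%N) else False}].

Lemma sub_tmatched S c c' T T' :
  template_in S T -> template_in S T' ->
  (forall t, triple_of S t -> c t -> c' t) ->
  tmatched c T T' -> tmatched c' T T'.
Proof.
move=> TS TS' cc [ps [du [eu [h1 h2 h3 h4 h5]]]].
have psT x : x \in ps -> x.1 \in T.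
  by move=> xps; rewrite (perm_mem h1) mem_cat map_f.
have psT' x : x \in ps -> x.2 \in T'.
  by move=> xps; rewrite (perm_mem h2) mem_cat map_f.
have duT x : x \in du -> x \in T.
  by move=> xdu; rewrite (perm_mem h1) mem_cat xdu orbT.
have euT x : x \in eu -> x \in T'.
  by move=> xeu; rewrite (perm_mem h2) mem_cat xeu orbT.
exists ps, du, eu; split=> // x xin.
- have [x1 x1S] := TS _ (psT x xin); have [x2 x2S] := TS' _ (psT' x xin).
  have [cx cx'] := h3 x xin; split.
    by apply: cc cx; rewrite /triple_of /= x1 x2.
  move: cx' x1S x2S; case: x.1.2 x.2.2 => [v|] [v'|] // cx' vS vS'.
  by apply: cc cx'; rewrite /triple_of /= vS // vS'.
- have [x1 x1S] := TS _ (duT x xin); move: (h4 x xin) x1S.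
  by case: x.2 => // v cx vS; apply: cc cx; rewrite /triple_of /= x1 vS.
- have [x1 x1S] := TS' _ (euT x xin); move: (h5 x xin) x1S.
  by case: x.2 => // v cx vS; apply: cc cx; rewrite /triple_of /= x1 vS.
Qed.

Definition monotone_on p T : bool := all weak (tdgm p T).

Lemma dpoint_dist_tev p (b : R) (x y : A * option A) :
  (dpoint_dist (tev p x) (tev p y) <= b%:E)%E <->
  cost p (x.1, y.1, 1%N) <= b /\
  match x.2, y.2 with
  | Some v, Some v' => cost p (v, v', 1%N) <= b
  | None, None => True
  | _, _ => False
  end.
Proof.
rewrite /dpoint_dist /tev /cost /= ge_max lee_fin !divr1.
split=> [/andP[h1 h2]|[h1 h2]].
  split=> //; move: h2; case: x.2 y.2 => [v|] [v'|] //; rewrite /death_dist /=.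
  by rewrite eqe; case: (p v =P p v') => [->|_]; rewrite ?subrr ?normr0 divr1.
apply/andP; split=> //; move: h2; case: x.2 y.2 => [v|] [v'|] //; rewrite /death_dist /=.
  by rewrite eqe; case: (p v =P p v') => [->|_]; rewrite ?subrr ?normr0 divr1.
by move=> _; rewrite lee_fin; apply: le_trans h1.
Qed.

Lemma half_pers_tev p (b : R) (x : A * option A) : weak (tev p x) ->
  (half_pers (tev p x) <= b%:E)%E <->
  if x.2 is Some v then cost p (x.1, v, 2%N) <= b else False.
Proof.
rewrite /weak /half_pers /tev /cost /=; case: x.2 => [v|] /=.
  rewrite !lee_fin => h; rewrite distrC ger0_norm ?subr_ge0 //.
by move=> _; rewrite addye // gt0_mulye ?lte_fin ?invr_gt0 // leye_eq.
Qed.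

Lemma matched_tmatched p (b : R) T T' :
  monotone_on p T -> monotone_on p T' ->
  matched b%:E (tdgm p T) (tdgm p T') -> tmatched (fun t => cost p t <= b) T T'.
Proof.
move=> /allP Tw /allP Tw' [ps [du [eu [h1 h2 h3 h4 h5]]]].
have [s1 p1 E1] := perm_map_lift h1; have [s2 p2 E2] := perm_map_lift h2.
have sz1 : (size ps <= size s1)%N.
  by have := congr1 size E1; rewrite size_cat !size_map => <-; exact: leq_addr.
have sz2 : (size ps <= size s2)%N.
  by have := congr1 size E2; rewrite size_cat !size_map => <-; exact: leq_addr.
pose k := size ps; pose zs := zip (take k s1) (take k s2).
have szk : size (take k s1) = size (take k s2) by rewrite !size_takel.
have z1 : [seq x.1 | x <- zs] = take k s1 by rewrite -/(unzip1 _) unzip1_zip ?szk.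
have z2 : [seq x.2 | x <- zs] = take k s2 by rewrite -/(unzip2 _) unzip2_zip ?szk.
have e1 : [seq x.1 | x <- ps] = map (tev p) (take k s1).
  by rewrite map_take -E1 take_size_cat ?size_map.
have e2 : [seq x.2 | x <- ps] = map (tev p) (take k s2).
  by rewrite map_take -E2 take_size_cat ?size_map.
have d1 : du = map (tev p) (drop k s1).
  by rewrite map_drop -E1 drop_size_cat ?size_map.
have d2 : eu = map (tev p) (drop k s2).
  by rewrite map_drop -E2 drop_size_cat ?size_map.
have psE : ps = [seq (tev p x.1, tev p x.2) | x <- zs].
  rewrite -[LHS](zip_unzip ps) /unzip1 /unzip2 e1 e2 -z1 -z2 -!map_comp.
  by elim: (zs) => //= z zs' ->.
exists zs, (drop k s1), (drop k s2); split.
- by rewrite z1 cat_take_drop.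
- by rewrite z2 cat_take_drop.
- move=> x xz; apply/dpoint_dist_tev; apply: (h3 (tev p x.1, tev p x.2)).
  by rewrite psE; apply/mapP; exists x.
- move=> x xd; apply/half_pers_tev.
    apply: Tw; apply: map_f; rewrite (perm_mem p1); exact: mem_drop xd.
  by apply: h4; rewrite d1 map_f.
- move=> x xd; apply/half_pers_tev.
    apply: Tw'; apply: map_f; rewrite (perm_mem p2); exact: mem_drop xd.
  by apply: h5; rewrite d2 map_f.
Qed.

Lemma tmatched_matched p (b : R) T T' :
  monotone_on p T -> monotone_on p T' ->
  tmatched (fun t => cost p t <= b) T T' -> matched b%:E (tdgm p T) (tdgm p T').
Proof.
move=> /allP Tw /allP Tw' [ps [du [eu [h1 h2 h3 h4 h5]]]].
exists [seq (tev p x.1, tev p x.2) | x <- ps], (map (tev p) du), (map (tev p) eu).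
split.
- by rewrite -map_comp (eq_map (g := tev p \o fst)) // map_comp -map_cat perm_map.
- by rewrite -map_comp (eq_map (g := tev p \o snd)) // map_comp -map_cat perm_map.
- by move=> _ /mapP[x xps ->]; apply/dpoint_dist_tev; exact: h3.
- move=> _ /mapP[x xdu ->]; apply/half_pers_tev; last exact: h4.
  by apply: Tw; rewrite map_f // (perm_mem h1) mem_cat xdu orbT.
- move=> _ /mapP[x xdu ->]; apply/half_pers_tev; last exact: h5.
  by apply: Tw'; rewrite map_f // (perm_mem h2) mem_cat xdu orbT.
Qed.

Definition tbot p T T' : \bar R := bottleneck (tdgm p T) (tdgm p T').

Lemma tbot_leP p (b : R) T T' :
  monotone_on p T -> monotone_on p T' -> 0 <= b ->
  (tbot p T T' <= b%:E)%E <-> tmatched (fun t => cost p t <= b) T T'.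
Proof.
move=> Tw Tw' b0; split=> [le_b|]; last first.
  by move=> /(tmatched_matched Tw Tw')/matched_bottleneck; apply; rewrite lee_fin.
apply: matched_tmatched => //.
have [ps [du [eu [h1 h2 h3 h4 h5]]]] := bottleneck_matched (tdgm p T) (tdgm p T').
exists ps, du, eu; split=> // x.
- by move=> /h3/le_trans; apply.
- by move=> /h4/le_trans; apply.
- by move=> /h5/le_trans; apply.
Qed.

Variable S : seq A.
Variables (T T' : seq (A * option A)).
Hypotheses (TS : template_in S T) (TS' : template_in S T').

(** The finitely many costs below [b] have a maximum, which already bounds the distance; [u] makes
    this family nonempty. *)
Lemma tbot_lt p (b : R) u :
  monotone_on p T -> monotone_on p T' -> u \in S -> 0 < b ->
  tmatched (fun t => cost p t < b) T T' -> (tbot p T T' < b%:E)%E.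
Proof.
move=> Tw Tw' uS b0 mT.
have hasu : has (fun t => cost p t < b) (triples S).
  apply/hasP; exists (u, u, 1%N); last by rewrite cost_diag.
  by rewrite mem_triples /triple_of /= uS.
have [t [_ tb tmax]] := seq_argmax (cost p) hasu.
apply: (@le_lt_trans _ _ (cost p t)%:E); last by rewrite lte_fin.
apply/tbot_leP => //; first exact: cost_ge0.
apply: (sub_tmatched TS TS' _ mT) => t' t'S tb'; by apply: tmax; rewrite ?mem_triples.
Qed.

Definition tcost p (ot : option (A * A * nat)) : \bar R :=
  if ot is Some t then (cost p t)%:E else +oo%E.

Definition cost_preserving p q : Prop :=
  forall t t', triple_of S t -> triple_of S t' ->
    cost p t <= cost p t' -> cost q t <= cost q t'.

(** A finite distance is one of the costs, for otherwise every cost bounded by it would be strictly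
    smaller, and so would the distance. The value [None] stands for an infinite distance. *)
Lemma tbot_attained p u :
  monotone_on p T -> monotone_on p T' -> u \in S ->
  exists ot, [/\ (forall t, ot = Some t -> triple_of S t),
    tbot p T T' = tcost p ot &
    forall q, monotone_on q T -> monotone_on q T' -> cost_preserving p q ->
      (tcost q ot <= tbot q T T')%E].
Proof.
move=> Tw Tw' uS; have b0 := bottleneck_ge0 (tdgm p T) (tdgm p T').
have uuS : triple_of S (u, u, 1%N) by rewrite /triple_of /= uS.
case bE: (tbot p T T') => [b| |]; last by move: b0; rewrite -/(tbot p T T') bE.
  have {}b0 : 0 <= b by move: b0; rewrite -/(tbot p T T') bE lee_fin.
  have mT : tmatched (fun t => cost p t <= b) T T' by apply/tbot_leP; rewrite // bE.
  have [/hasP[t]|no] := boolP (has (fun t => cost p t == b) (triples S)); last first.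
    have ltb t : triple_of S t -> cost p t <= b -> cost p t < b.
      rewrite -mem_triples lt_neqAle => tS ->; rewrite andbT.
      by apply: contra no => tb; apply/hasP; exists t.
    have : (tbot p T T' < b%:E)%E.
      apply: (@tbot_lt p b u) => //; first by rewrite -(cost_diag p u 1) ltb // cost_diag.
      exact: (sub_tmatched TS TS' ltb mT).
    by rewrite bE ltxx.
  rewrite mem_triples => tS /eqP tb; exists (Some t); split=> [_ [<-]//||q qT qT' pq].
    by rewrite /= tb.
  rewrite leNgt; apply/negP => lt_t.
  have q0 := bottleneck_ge0 (tdgm q T) (tdgm q T').
  case qE: (tbot q T T') lt_t => [b'| |]; rewrite ?ltNge ?leey //; last first.
    by move=> _; move: q0; rewrite -/(tbot q T T') qE.
  rewrite -ltNge lte_fin => lt_t.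
  have {}q0 : 0 <= b' by move: q0; rewrite -/(tbot q T T') qE lee_fin.
  have mq : tmatched (fun t => cost q t <= b') T T' by apply/tbot_leP; rewrite // qE.
  (* A matching cheaper than [t] along [q] uses only triples cheaper than [t] along [p], because the
     weak order of costs is preserved. *)
  have ltp t' : triple_of S t' -> cost q t' <= b' -> cost p t' < b.
    move=> t'S le_t'; rewrite ltNge; apply/negP; rewrite -tb => /(pq _ _ tS t'S) tt'.
    by have := le_lt_trans (le_trans tt' le_t') lt_t; rewrite ltxx.
  have : (tbot p T T' < b%:E)%E.
    apply: (@tbot_lt p b u) => //; last exact: (sub_tmatched TS TS' ltp mq).
    by rewrite -(cost_diag p u 1) ltp // cost_diag.
  by rewrite bE ltxx.
(* A finite distance along [q] gives a matching of names, whose cost along [p] is finite too, being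
   bounded by the largest cost of a triple. *)
exists None; split=> // q qT qT' _; rewrite leye_eq; apply/eqP.
have q0 := bottleneck_ge0 (tdgm q T) (tdgm q T').
case qE: (tbot q T T') => [b'|//|]; last by move: q0; rewrite -/(tbot q T T') qE.
have {}q0 : 0 <= b' by move: q0; rewrite -/(tbot q T T') qE lee_fin.
have mq : tmatched (fun t => cost q t <= b') T T' by apply/tbot_leP; rewrite // qE.
have hasu : has predT (triples S).
  by apply/hasP; exists (u, u, 1%N); rewrite ?mem_triples.
have [t [_ _ tmax]] := seq_argmax (cost p) hasu.
have : (tbot p T T' <= (cost p t)%:E)%E.
  apply/tbot_leP => //; first exact: cost_ge0.
  apply: (sub_tmatched TS TS' _ mq) => t' t'S _; by apply: tmax; rewrite ?mem_triples.
by rewrite bE leye_eq.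
Qed.

Lemma le_tbot p q (k : R) :
  monotone_on p T -> monotone_on p T' -> monotone_on q T -> monotone_on q T' ->
  0 < k ->
  (forall t, triple_of S t -> cost q t <= k * cost p t) ->
  (tbot q T T' <= k%:E * tbot p T T')%E.
Proof.
move=> pT pT' qT qT' k0 pq; have b0 := bottleneck_ge0 (tdgm p T) (tdgm p T').
case bE: (tbot p T T') => [b| |]; last by move: b0; rewrite -/(tbot p T T') bE.
  have {}b0 : 0 <= b by move: b0; rewrite -/(tbot p T T') bE lee_fin.
  rewrite -EFinM; apply/tbot_leP => //; first by rewrite mulr_ge0 // ltW.
  have /(tbot_leP pT pT' b0) : (tbot p T T' <= b%:E)%E by rewrite bE.
  apply: (sub_tmatched TS TS') => t tS tb; apply: le_trans (pq t tS) _.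
  by rewrite ler_pM2l.
by rewrite gt0_muley ?lte_fin // leey.
Qed.

End Templates.

(* [rk X Y] stands for the rank of the map from the maximum of the critical
   values in [X] to the maximum of those in [Y]. *)
Section ValidTemplates.
Context {R : realType} {A : eqType}.
Variables (rk : set A -> set A -> nat) (S : seq A).
Implicit Types (p q : A -> R) (T : seq (A * option A)).

Definition sublevel p (s : R) : set A := [set u | u \in S /\ p u <= s].

Definition valid_template p T : Prop :=
  [/\ template_in S T, monotone_on p T &
      forall s t : R, s <= t ->
        count (alive s t) (tdgm p T) = rk (sublevel p s) (sublevel p t)].

(** Passing from [p] to [q] may create ties but neither breaks ties nor reverses the order. *)
Definition coarsens p q : Prop :=
  {in S &, forall u v, p u <= p v -> q u <= q v}.

(** The level [s'] is the largest [p] value among the names whose [q] value is at most [s]. *)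
Lemma coarsens_level p q (s : R) :
  coarsens p q -> exists s', {in S, forall u, (q u <= s) = (p u <= s')}.
Proof.
move=> pq; have [/(seq_argmax p)[u [uS us umax]]|no] :=
  boolP (has (fun u => q u <= s) S).
  exists (p u) => v vS; apply/idP/idP => [vs|vu]; first exact: umax.
  by apply: le_trans us; exact: pq.
have {no}no v : v \in S -> ~~ (q v <= s).
  by move=> vS; apply: contra no => vs; apply/hasP; exists v.
case SE: S => [|a S']; first by exists 0.
have [|u [_ _ umin]] := @seq_argmin _ _ _ p predT S; first by rewrite SE.
(* No name has a [q] value up to [s]; a level below all values of [p] gives the empty set as
   well. *)
exists (p u - 1) => v vS; rewrite -SE in vS.
rewrite (negbTE (no v vS)); symmetry; apply/negbTE; rewrite -ltNge.
by apply: lt_le_trans (umin v vS isT); rewrite ltrBlDr ltrDl.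
Qed.

(** The sublevel sets of [q] are among those of [p], so the rank equations for [q] are instances of
    those for [p]. *)
Lemma valid_coarsen p q T :
  coarsens p q -> valid_template p T -> valid_template q T.
Proof.
move=> pq [TS Tp Tc]; split=> //.
  apply/allP => _ /mapP[x xT ->]; rewrite /weak /tev /=.
  have [x1 x2] := TS x xT; case xE: x.2 x2 => [v|] x2; last exact: leey.
  rewrite lee_fin; apply: pq => //; first exact: x2.
  have /allP/(_ (tev p x)) := Tp; rewrite map_f // /weak /tev /= xE lee_fin.
  exact.
move=> s t st; have [s' sE] := coarsens_level s pq; have [t' tE] := coarsens_level t pq.
(* The levels [s'] and [t'] need not be ordered; the minimum cuts out the same set as [s']. *)
pose r := Num.min s' t'.
have rE : {in S, forall u, (q u <= s) = (p u <= r)}.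
  move=> u uS; rewrite le_min -sE // -tE //.
  by case: (boolP (q u <= s)) => //= us; rewrite (le_trans us st).
have rt : r <= t' by rewrite ge_min lexx orbT.
have -> : sublevel q s = sublevel p r.
  by apply/seteqP; split=> u [uS]; [rewrite rE|rewrite -rE].
have -> : sublevel q t = sublevel p t'.
  by apply/seteqP; split=> u [uS]; [rewrite tE|rewrite -tE].
rewrite -Tc // !count_map; apply: eq_in_count => x xT.
rewrite /alive /tev /=; have [x1 x2] := TS x xT; rewrite rE //.
case: x.2 x2 => [v|] x2; last by rewrite !ltry.
by rewrite !lte_fin !ltNge tE //; exact: x2.
Qed.

Lemma valid_same_counts p T T' :
  valid_template p T -> valid_template p T' -> same_counts (tdgm p T) (tdgm p T').
Proof. by move=> [_ _ Tc] [_ _ Tc'] s t st; rewrite Tc ?Tc'. Qed.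

End ValidTemplates.

Lemma tbot_valid {R : realType} {A : eqType} rk rk' (S S' : seq A) (p : A -> R)
    T1 T2 T1' T2' :
  valid_template rk S p T1 -> valid_template rk S p T2 ->
  valid_template rk' S' p T1' -> valid_template rk' S' p T2' ->
  tbot p T1 T1' = tbot p T2 T2'.
Proof.
move=> v1 v2 v1' v2'; have [_ w1 _] := v1; have [_ w2 _] := v2.
have [_ w1' _] := v1'; have [_ w2' _] := v2'.
exact: bottleneck_same_counts w2 w1 w2' w1' (valid_same_counts v2 v1)
  (valid_same_counts v2' v1').
Qed.

(** * Limits at the end of a segment of parameters *)

Section SegmentLimit.
Context {R : realType} {A : eqType}.
Variables (S : seq A) (p0 p1 : A -> R).

Definition segment (tau : R) (u : A) : R := (1 - tau) * p0 u + tau * p1 u.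

Hypothesis same_sign : forall tau t t', 0 <= tau < 1 ->
  triple_of S t -> triple_of S t' ->
  Num.sg (cost (segment tau) t - cost (segment tau) t')
  = Num.sg (cost p0 t - cost p0 t').

(** The reverse triangle inequality gives an explicit rate for the limit [tau -> 1]. *)
Lemma segment_dist tau (t : A * A * nat) : 0 <= tau <= 1 ->
  `|cost (segment tau) t - tau * cost p1 t| <= (1 - tau) * cost p0 t.
Proof.
case: t => [[u v] d] /andP[tau0 tau1]; rewrite /cost /=.
rewrite !mulrA -mulrBl normrM (@ger0_norm _ d%:R^-1) ?invr_ge0 //.
rewrite ler_wpM2r ?invr_ge0 //.
have -> : tau * `|p1 u - p1 v| = `|tau * (p1 u - p1 v)|.
  by rewrite normrM (ger0_norm tau0).
have -> : (1 - tau) * `|p0 u - p0 v| = `|(1 - tau) * (p0 u - p0 v)|.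
  by rewrite normrM (@ger0_norm _ (1 - tau)) ?subr_ge0.
apply: le_trans (ler_dist_dist _ _) _.
by rewrite /segment le_eqVlt; apply/orP; left; apply/eqP; congr (`|_|); ring.
Qed.

Lemma segment_cost_preserving : cost_preserving S p0 p1.
Proof.
move=> t t' tS t'S le0; rewrite leNgt; apply/negP => lt1.
set D := cost p1 t - cost p1 t'; have D0 : 0 < D by rewrite subr_gt0.
set K := cost p0 t + cost p0 t'; have K0 : 0 <= K by rewrite addr_ge0 ?cost_ge0.
(* The remaining weight [r] is so small that the error [r * K] stays below [D / 2], while [r <= 1/2]
   keeps [tau * D] at least [D / 2]. *)
pose r := D / (2 * (K + D)); pose tau := 1 - r.
have KD : 0 < K + D by rewrite ltr_wpDl.
have r0 : 0 < r by rewrite divr_gt0 // mulr_gt0.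
have r12 : r <= 2^-1.
  by rewrite /r ler_pdivrMr ?mulr_gt0 // mulrA mulVf // mul1r lerDr.
have rK : r * K < D / 2.
  have -> : r * K = (D / 2) * (K / (K + D)) by rewrite /r; field; rewrite gt_eqF.
  by rewrite gtr_pMr ?divr_gt0 // ltr_pdivrMr // mul1r ltrDl.
have tau01 : 0 <= tau < 1 by rewrite /tau; apply/andP; split; lra.
have tau01' : 0 <= tau <= 1 by case/andP: tau01 => -> /ltW.
have le_tau : cost (segment tau) t - cost (segment tau) t' <= 0.
  by rewrite -sgr_le0 same_sign // sgr_le0 subr_le0.
have := segment_dist t tau01'; have := segment_dist t' tau01'.
have tauE : 1 - tau = r by rewrite /tau; ring.
rewrite tauE !ler_norml => /andP[_ h'] /andP[h _].
have : tau * D <= r * K by rewrite /D /K mulrBr mulrDr; lra.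
have : 2^-1 * D <= tau * D by rewrite ler_pM2r //; lra.
by lra.
Qed.

(** A tie between [u] and [v] is a comparison of the triples [(u, v, 1)] and [(u, u, 1)], so ties
    before the end of the segment are those at [p0]. *)
Lemma segment_coarsens : coarsens S p0 p1.
Proof.
move=> u v uS vS le0; rewrite leNgt; apply/negP => lt1.
pose g (tau : R) := segment tau u - segment tau v.
have g0 : forall tau, 0 <= tau < 1 -> (g tau == 0) = (p0 u == p0 v).
  move=> tau tau01.
  have := same_sign (t := (u, v, 1%N)) (t' := (u, u, 1%N)) tau01.
  rewrite /triple_of /= uS vS => /(_ isT isT).
  rewrite !cost_diag !subr0 /cost /= !divr1 => sE.
  by rewrite /g -normr_eq0 -sgr_eq0 sE sgr_eq0 normr_eq0 subr_eq0.
have [e0|ne0] := eqVneq (p0 u) (p0 v).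
  (* Two zeros of the affine function [g], at 0 and at 1/2, force a third one at 1. *)
  have := g0 2^-1; rewrite e0 eqxx /g /segment e0 => /(_ _)/eqP; lra.
have lt0 : p0 u < p0 v by rewrite lt_neqAle ne0.
set a := p0 v - p0 u; set b := p1 u - p1 v.
have a0 : 0 < a by rewrite subr_gt0.
have b0 : 0 < b by rewrite subr_gt0.
(* If the order were reversed at the end, the two values would coincide at this parameter. *)
have tau01 : 0 <= a / (a + b) < 1.
  apply/andP; split; first exact: divr_ge0 (ltW a0) (ltW (addr_gt0 a0 b0)).
  rewrite ltr_pdivrMr; last exact: addr_gt0.
  by rewrite mul1r ltrDl.
have := g0 _ tau01; rewrite (negbTE ne0) => /negP; apply; apply/eqP.
rewrite /g /segment.
have -> : p0 u = p0 v - a by rewrite /a; ring.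
have -> : p1 u = p1 v + b by rewrite /b; ring.
by field; rewrite gt_eqF // addr_gt0.
Qed.

End SegmentLimit.

(** * Lines and pushes *)

Section PushParameter.
Context {R : realType}.
Implicit Types (L : line R) (u v : plane R).

Lemma plane_leE u v : (u <= v)%O = (u.1 <= v.1) && (u.2 <= v.2).
Proof. by rewrite leEprod. Qed.

Lemma boundary_quadrantP u (w : R * R) :
  boundary [set v : R * R | (u <= (v : plane R))%O] w <->
  (u <= (w : plane R))%O /\ ~ (u.1 < w.1 /\ u.2 < w.2).
Proof.
set Q := [set v : R * R | _].
have QE : Q = (fst @^-1` [set x | u.1 <= x]) `&` (snd @^-1` [set x | u.2 <= x]).
  apply/seteqP; split=> v; rewrite /Q /= plane_leE; first by case/andP.
  by move=> h; apply/andP.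
have Qclosed : closed Q.
  rewrite QE; apply: closedI.
    by apply: closed_comp => [x _|]; [exact: cvg_fst|exact: closed_ge].
  by apply: closed_comp => [x _|]; [exact: cvg_snd|exact: closed_ge].
rewrite /boundary -(closure_id Q).1 //; split=> [[uw nint]|[uw nlt]]; split=> //.
  move=> [lt1 lt2]; apply: nint.
  pose Q' : set (R * R) :=
    (fst @^-1` [set x | u.1 < x]) `&` (snd @^-1` [set x | u.2 < x]).
  have Q'open : open Q'.
    apply: openI.
      by apply: open_comp => [x _|]; [exact: cvg_fst|exact: open_gt].
    by apply: open_comp => [x _|]; [exact: cvg_snd|exact: open_gt].
  have : nbhs w Q' by apply: open_nbhs_nbhs.
  by apply: filterS => v [/= h1 h2]; rewrite /Q /= plane_leE !ltW.
move=> wint; apply: nlt.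
have /nbhs_ballP[e /= e0 we] : nbhs w Q by [].
(* A point of the ball to the lower left of [w] still dominates [u], so [w] does so strictly. *)
have h : Q (w.1 - e / 2, w.2 - e / 2).
  apply: we; split; rewrite /ball /= opprB addrC subrK ger0_norm ?divr_ge0 ?ltW //;
    by rewrite ltr_pdivrMr // ltr_pMr // ltr1n.
by move: h; rewrite /Q /= plane_leE /= => /andP[h1 h2]; split; clear -h1 h2 e0; lra.
Qed.

(** The line lies in the quadrant once it has passed both coordinates of [u], and on its boundary
    exactly when the later one is reached. *)
Lemma is_push_paramP L u (s : R) :
  is_push_param L u s <->
  s = Num.max ((u.1 - (loff L).1) / (ldir L).1) ((u.2 - (loff L).2) / (ldir L).2).
Proof.
have m1 := ldir1_gt0 L; have m2 := ldir2_gt0 L.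
rewrite /is_push_param boundary_quadrantP plane_leE /=.
rewrite -!lerBlDr -!ltrBlDr -!(mulrC s) -!ler_pdivrMr // -!ltr_pdivrMr //.
move: (_ / _) (_ / _) => a b; split.
  move=> [/andP[sa sb] nlt]; apply/eqP; rewrite eq_le ge_max sa sb andbT.
  rewrite le_max !leNgt -negb_and andbT; apply/negP => /andP h; exact: nlt.
move=> ->; rewrite !le_max !lexx orbT; split=> //.
by rewrite !lt_max !ltxx orbF /= => -[/lt_trans h /h]; rewrite ltxx.
Qed.

Lemma push_paramE L u :
  push_param L u =
  Num.max ((u.1 - (loff L).1) / (ldir L).1) ((u.2 - (loff L).2) / (ldir L).2).
Proof.
apply: (@xget_unique _ _ [set s | is_push_param L u s]).
  exact/is_push_paramP.
by move=> s /is_push_paramP.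
Qed.

(** This identifies the sublevel sets of [push_param] with the sets of critical values below a point
    of the line, the form in which Property (P) is used. *)
Lemma push_param_le L u (s : R) :
  (push_param L u <= s) = (u <= lpoint L s)%O.
Proof.
rewrite push_paramE plane_leE /= ge_max !ler_pdivrMr ?ldir1_gt0 ?ldir2_gt0 //.
by rewrite !lerBlDr ![_ * s]mulrC.
Qed.

Lemma line_eq L L' : ldir L = ldir L' -> loff L = loff L' -> L = L'.
Proof.
case: L L' => [m b h1 h2 h3 h4] [m' b' h1' h2' h3' h4'] /= mm bb.
by subst m' b'; congr Line; exact: eq_irrelevance.
Qed.

End PushParameter.

Lemma pm_rank_refl {F : fieldType} {d} {T : porderType d} (V : pmod T F) (s : T)
    (h : (s <= s)%O) : pm_rank V h = \dim (fullv : {vspace V s}).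
Proof. by rewrite /pm_rank pm_id lim1g. Qed.

Lemma pm_map_bij {F : fieldType} {d} {T : porderType d} (V : pmod T F) (s t : T)
    (h : (s <= t)%O) :
  pm_rank V h = pm_rank V (lexx s) -> pm_rank V h = pm_rank V (lexx t) ->
  injective (pm_map V h) /\ forall y, exists x, y = pm_map V h x.
Proof.
rewrite !pm_rank_refl /pm_rank => rs rt; split.
  apply/lker0P; rewrite -dimv_eq0 -(eqn_add2r (\dim (limg (pm_map V h)))) add0n.
  by have := limg_ker_dim (pm_map V h) fullv; rewrite capfv => ->; rewrite rs.
move=> y; have : y \in limg (pm_map V h).
  suff -> : limg (pm_map V h) = fullv by rewrite memvf.
  by apply/eqP; rewrite -(geq_leqif (dimv_leqif_eq (subvf _))) rt.
by case/memv_imgP=> x _ ->; exists x.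
Qed.

(** * Naming the diagram of a restriction by critical values *)

Section LineTemplates.
Context {R : realType} {F : fieldType}.
Variables (M : pmod (plane R) F).
Implicit Types (L : line R) (u v : plane R).

Definition is_max_of (X : set (plane R)) u : Prop :=
  X u /\ forall w, X w -> (w <= u)%O.

(** The default 0 covers an empty [X], in agreement with Property (P). *)
Definition max_rank (X Y : set (plane R)) : nat :=
  xget 0%N [set n | exists u v (h : (u <= v)%O),
    [/\ is_max_of X u, is_max_of Y v & n = pm_rank M h]].

Lemma max_rankE X Y u v (h : (u <= v)%O) :
  is_max_of X u -> is_max_of Y v -> max_rank X Y = pm_rank M h.
Proof.
move=> [Xu umax] [Yv vmax]; apply: xget_unique; first by exists u, v, h.
move=> _ [u' [v' [h' [[Xu' umax'] [Yv' vmax'] ->]]]].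
have uE : u' = u by apply/le_anti; rewrite umax ?umax'.
have vE : v' = v by apply/le_anti; rewrite vmax ?vmax'.
by subst u' v'; exact: pm_rank_irr.
Qed.

Lemma max_rank0 Y : max_rank set0 Y = 0%N.
Proof. by rewrite /max_rank; case: xgetP => // n _ [u [v [h [[]]]]]. Qed.

Variables (C : set (plane R)) (S : seq (plane R)).
Hypothesis MP : propP M C.
Hypothesis SE : forall u, lub_closure C u <-> u \in S.

Lemma line_restr_rank L (s t : R) (h : (s <= t)%O) :
  pm_rank (line_restr M L) h
  = max_rank (sublevel S (push_param L) s) (sublevel S (push_param L) t).
Proof.
have -> : pm_rank (line_restr M L) h = pm_rank M (@lpoint_homo R L s t h) by [].
have subE (r : R) w : sublevel S (push_param L) r w <->
    lub_closure C w /\ (w <= lpoint L r)%O.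
  by rewrite SE /sublevel /= push_param_le.
have maxE (r : R) w : is_max_below (lub_closure C) (lpoint L r) w ->
    is_max_of (sublevel S (push_param L) r) w.
  move=> [Cw wr wmax]; split; first exact/subE.
  by move=> x /subE[Cx xr]; exact: wmax.
have [_ _ /(_ _ _ (@lpoint_homo R L s t h))[rank_ne rank_0]] := MP.
have [ne|e0] := pselect ([set w | lub_closure C w /\ (w <= lpoint L s)%O] !=set0).
  have [u' [v' [h' [/maxE umax /maxE vmax ->]]]] := rank_ne ne.
  by rewrite (max_rankE h' umax vmax).
have {}e0 : [set w | lub_closure C w /\ (w <= lpoint L s)%O] = set0.
  by apply/seteqP; split=> // w Cw; apply: e0; exists w.
rewrite rank_0 // (_ : sublevel S (push_param L) s = set0) ?max_rank0 //.
by apply/seteqP; split=> // w /subE Cw; rewrite -[set0]e0.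
Qed.

(** With no pushed critical value in [(s, t]] the sublevel sets at [s] and [t] agree, so the map has
    the rank of the identity at both ends. *)
Lemma line_restr_tame L :
  tame (line_restr M L) [seq push_param L u | u <- S].
Proof.
split=> [s s_lt|s t h noc].
  apply: pm_rank_refl0; rewrite line_restr_rank.
  rewrite (_ : sublevel S (push_param L) s = set0) ?max_rank0 //.
  apply/seteqP; split=> // w [wS]; rewrite leNgt s_lt //.
  by apply/mapP; exists w.
have st : sublevel S (push_param L) s = sublevel S (push_param L) t.
  apply/seteqP; split=> w [wS wle]; split=> //; first exact: le_trans h.
  by apply: noc => //; apply/mapP; exists w.
by apply: pm_map_bij; rewrite !line_restr_rank st.
Qed.

(** The diagram chosen by [dgm] is a permutation of the one from [tame_dgm], whose finite end points
    are pushes of critical values and can be named. *)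
Lemma line_template L : exists T,
  valid_template max_rank S (push_param L) T /\
  tdgm (push_param L) T = dgm (line_restr M L).
Proof.
have [D Ddgm Din] := tame_dgm (line_restr_tame L).
set E := dgm _; have Edgm : is_dgm (line_restr M L) E.
  by apply: (@xgetPex _ [::] [set D | is_dgm (line_restr M L) D]); exists D.
have DE : perm_eq D E.
  apply: same_counts_perm; [by case: Ddgm|by case: Edgm|] => s t st.
  by rewrite -(pm_rank_dgm st Ddgm) -(pm_rank_dgm st Edgm).
have {}Din : endpoints_in [seq push_param L u | u <- S] E.
  by rewrite /endpoints_in -(perm_all _ DE).
have [T [TS TE]] : exists T, template_in S T /\ tdgm (push_param L) T = E.
  elim: (E) Din => [|p E' IH] /=; first by exists [::].
  case/andP=> /andP[/mapP[u uS p1] p2] /IH[T [TS <-]].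
  case/orP: p2 => [/eqP p2|/mapP[b /mapP[v vS ->] p2]].
    exists ((u, None) :: T); split; last first.
      by rewrite /tdgm /= /tev /= -p1 -p2 -surjective_pairing.
    by move=> x; rewrite inE => /orP[/eqP->|/TS//].
  exists ((u, Some v) :: T); split; last first.
    by rewrite /tdgm /= /tev /= -p1 -p2 -surjective_pairing.
  by move=> x; rewrite inE => /orP[/eqP->|/TS//]; split=> // _ [<-].
exists T; split=> //; split=> //.
  rewrite /monotone_on TE; case: Edgm => /allP Elt _; apply/allP => p /Elt.
  exact: ltW.
by move=> s t st; rewrite TE -(pm_rank_dgm st Edgm) line_restr_rank.
Qed.

End LineTemplates.

(** * Lines in slope and intercept coordinates *)

Section SlopeLines.
Context {R : realType}.
Implicit Types (L : line R) (u v : plane R) (mu c : R) (sw : bool).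

(* The lines of slope at most 1 are [y = mu x + c] and those of slope at least 1
   are [x = mu y + c], with [0 < mu <= 1]; [sw] selects the second family. Junk
   values of [mu] are replaced by 1. *)
Definition clip mu : R := if 0 < mu <= 1 then mu else 1.

Lemma clip_gt0 mu : 0 < clip mu.
Proof. by rewrite /clip; case: ifP => // /andP[]. Qed.

Lemma clip_le1 mu : clip mu <= 1.
Proof. by rewrite /clip; case: ifP => // /andP[]. Qed.

Lemma clipE mu : 0 < mu <= 1 -> clip mu = mu.
Proof. by rewrite /clip => ->. Qed.

Definition slope_dir sw mu : R * R := if sw then (clip mu, 1) else (1, clip mu).

(** The point where the line meets the antidiagonal, as the normalization of offsets demands. *)
Definition slope_off sw mu c : R * R :=
  let t := c / (1 + clip mu) in if sw then (t, - t) else (- t, t).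

Fact slope_dir1_gt0 sw mu : 0 < (slope_dir sw mu).1.
Proof. by case: sw; rewrite //= clip_gt0. Qed.
Fact slope_dir2_gt0 sw mu : 0 < (slope_dir sw mu).2.
Proof. by case: sw; rewrite //= clip_gt0. Qed.
Fact slope_dir_max sw mu : Num.max (slope_dir sw mu).1 (slope_dir sw mu).2 = 1.
Proof. by case: sw => /=; [apply/max_idPr|apply/max_idPl]; exact: clip_le1. Qed.
Fact slope_off_sum sw mu c : (slope_off sw mu c).1 + (slope_off sw mu c).2 = 0.
Proof. by case: sw => /=; rewrite ?subrr ?addNr. Qed.

Definition slope_line sw mu c : line R :=
  Line (slope_dir1_gt0 sw mu) (slope_dir2_gt0 sw mu) (slope_dir_max sw mu)
    (slope_off_sum sw mu c).

Definition absc sw (u : R * R) : R := if sw then u.2 else u.1.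
Definition ordi sw (u : R * R) : R := if sw then u.1 else u.2.

Definition height sw mu c u : R := Num.max (mu * absc sw u + c) (ordi sw u).
(** The signed offset of [u] from the line along the [ordi] axis. For a point at infinity the same
    formula with [c = 0] compares slopes. *)
Definition above sw mu c u : R := ordi sw u - mu * absc sw u - c.

Lemma mhat_slope sw mu c : 0 < mu <= 1 -> mhat (slope_line sw mu c) = mu.
Proof.
move=> h; have /andP[_ mu1] := h; rewrite /mhat /= /slope_dir clipE //.
by case: sw => /=; [apply/min_idPl|apply/min_idPr].
Qed.

(** The term [c / (1 + mu)] is common to all points and cancels in every cost. *)
Lemma push_slope sw mu c u : 0 < mu <= 1 ->
  push_param (slope_line sw mu c) u
  = mu^-1 * (height sw mu c u - c / (1 + mu)).
Proof.
move=> h; have /andP[mu0 _] := h; have mu1 : 1 + mu != 0 by rewrite gt_eqF ?addr_gt0.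
rewrite push_paramE /= /slope_dir /slope_off clipE // /height.
have maxE a b a' b' t : a = mu^-1 * (a' - t) -> b = mu^-1 * (b' - t) ->
    Num.max a b = mu^-1 * (Num.max a' b' - t).
  move=> -> ->; rewrite !maxElt ltr_pM2l ?invr_gt0 // ltrD2r.
  by case: ifP.
have mun : mu != 0 by rewrite gt_eqF.
by case: sw => /=; [rewrite maxC|]; apply: maxE; field; rewrite ?mu1 ?mun.
Qed.

Lemma slope_line_surj L : exists sw mu c, 0 < mu <= 1 /\ L = slope_line sw mu c.
Proof.
case: L => [[m1 m2] [b1 b2] /= h1 h2 hm hb].
have b2E : b2 = - b1 by apply/eqP; rewrite -addr_eq0 addrC hb.
have [m12|m21] := leP m1 m2.
  have m2E : m2 = 1 by rewrite -hm; apply/esym/max_idPr.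
  have mu01 : 0 < m1 <= 1 by rewrite h1 -m2E.
  exists true, m1, (b1 * (1 + m1)); split=> //; apply: line_eq => /=.
    by rewrite /slope_dir clipE // m2E.
  by rewrite /slope_off clipE // mulfK ?b2E // gt_eqF ?addr_gt0.
have m1E : m1 = 1 by rewrite -hm; apply/esym/max_idPl/ltW.
have mu01 : 0 < m2 <= 1 by rewrite h2 -m1E ltW.
exists false, m2, (b2 * (1 + m2)); split=> //; apply: line_eq => /=.
  by rewrite /slope_dir clipE // m1E.
by rewrite /slope_off clipE // mulfK ?b2E ?opprK // gt_eqF ?addr_gt0.
Qed.

Lemma on_slope_affine sw mu c u : 0 < mu <= 1 ->
  on_line (slope_line sw mu c) (Affine u) <-> above sw mu c u = 0.
Proof.
move=> h; have /andP[mu0 _] := h; have mu1 : 1 + mu != 0 by rewrite gt_eqF ?addr_gt0.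
rewrite /on_line /lpoint /= /slope_dir /slope_off clipE // /above.
case: u => u1 u2; case: sw => /=; split.
- by move=> [s [<- <-]]; field.
- move=> e; exists (u2 + c / (1 + mu)); congr pair; last by field.
  have -> : u1 = mu * u2 + c by lra.
  by field.
- by move=> [s [<- <-]]; field.
- move=> e; exists (u1 + c / (1 + mu)); congr pair; first by field.
  have -> : u2 = mu * u1 + c by lra.
  by field.
Qed.

Lemma on_slope_infty sw mu c (v : R * R) : 0 < mu <= 1 ->
  on_line (slope_line sw mu c) (Infty v) <-> above sw mu 0 v = 0.
Proof.
move=> h; rewrite /on_line /= /slope_dir clipE // /above.
by case: v => v1 v2; case: sw => /=; split; lra.
Qed.

(** Exchanging the coordinates exchanges 1 and 2, hence the comparison with [sw]. *)
Definition recip_sign sw (s : R) : set nat :=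
  if s == 0 then [set 1; 2]%N
  else if (s < 0) != sw then [set 1]%N else [set 2]%N.

Lemma recip_affine sw mu c u : 0 < mu <= 1 ->
  recip (slope_line sw mu c) (Affine u) = recip_sign sw (Num.sg (above sw mu c u)).
Proof.
move=> h; have /andP[mu0 _] := h; have mu1 : 0 < 1 + mu by rewrite addr_gt0.
rewrite /recip /recip_sign sgr_eq0; case: asboolP => [/on_slope_affine|off].
  by move=> /(_ h) ->; rewrite eqxx.
have /negbTE a0 : above sw mu c u != 0.
  by apply/eqP => a0; apply: off; exact/on_slope_affine.
rewrite a0 sgr_lt0 /push push_slope // /lpoint /= /slope_dir /slope_off clipE //.
rewrite /height; move: a0; rewrite /above; case: u {off} => u1 u2.
set t := c / (1 + mu); have tE : c = t + mu * t.
  by rewrite /t; field; rewrite gt_eqF.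
have mulK x : mu * (mu^-1 * x) = x by rewrite mulrA mulfV ?mul1r ?gt_eqF.
have mun : mu != 0 by rewrite gt_eqF.
case: sw => /= /negbT; rewrite neq_lt => /orP[lt_a|lt_a]; rewrite ?lt_a ?(lt_gtF lt_a) /=.
- rewrite max_l ?mulK ?subrK; last by lra.
  by rewrite gt_eqF //=; lra.
- rewrite max_r ?mulK ?subrK ?eqxx /=; last by lra.
  rewrite mul1r ltrBrDr -(ltr_pM2l mu0) mulK.
  by rewrite (_ : _ < _) //; lra.
- rewrite max_l ?mulK ?subrK; last by lra.
  have -> : 1 * (mu^-1 * (mu * u1 + c - t)) - t = u1 by rewrite tE; field.
  by rewrite eqxx /= (_ : u2 < _) //; lra.
- rewrite max_r ?mulK ?subrK ?ltxx ?andbF //; lra.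
Qed.

Lemma recip_infty sw mu c (v : R * R) : 0 < mu <= 1 -> 0 < v.1 -> 0 < v.2 ->
  recip (slope_line sw mu c) (Infty v) = recip_sign sw (Num.sg (above sw mu 0 v)).
Proof.
move=> h; have /andP[mu0 _] := h; case: v => v1 v2 /= v10 v20.
rewrite /recip /recip_sign sgr_eq0 sgr_lt0 /= /slope_dir clipE // /above.
have mun : mu != 0 by rewrite gt_eqF.
case: sw => /=.
  have -> : (v1 - mu * v2 - 0 == 0) = (mu * v2 == 1 * v1).
    by apply/eqP/eqP; lra.
  case: eqP => // /eqP ne.
  rewrite ltr_pdivrMr // mulrAC mul1r ltr_pdivlMr // [v2 * mu]mulrC.
  move: ne; rewrite mul1r neq_lt => /orP[lt_a|lt_a]; rewrite ?lt_a ?(lt_gtF lt_a).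
    by rewrite (_ : (_ < 0) = false) //; apply/negbTE; rewrite -leNgt; lra.
  by rewrite (_ : (_ < 0) = true) //; lra.
have -> : (v2 - mu * v1 - 0 == 0) = (1 * v2 == mu * v1).
  by apply/eqP/eqP; lra.
case: eqP => // /eqP ne; rewrite ltr_pdivrMr // divr1.
have -> : (v2 < mu * v1) = (v2 - mu * v1 - 0 < 0) by apply/idP/idP; lra.
by case: (_ < 0).
Qed.

End SlopeLines.

(** The closure stays in the finite grid spanned by the coordinates occurring in [C], which is
    stable under joins. *)
Lemma lub_closure_finite {R : realType} (C : set (plane R)) :
  finite_set C -> exists S : seq (plane R), forall u, lub_closure C u <-> u \in S.
Proof.
move=> /finite_seqP[s Cs].
suff : finite_set (lub_closure C).
  by move=> /finite_seqP[S ->]; exists S.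
pose G : seq (plane R) := [seq (x, y) | x <- [seq u.1 | u <- s], y <- [seq u.2 | u <- s]].
apply: (@sub_finite_set _ _ [set` G]); last by apply/finite_seqP; exists G.
apply: smallest_sub => [u v /= /allpairsP[[a b] /= [aS bS ->]]|u]; last first.
  rewrite Cs /= => us; apply/allpairsP; exists (u.1, u.2).
  split; last exact: surjective_pairing.
    exact: (map_f (fun u : plane R => u.1) us).
  exact: (map_f (fun u : plane R => u.2) us).
move=> /allpairsP[[a' b'] /= [aS' bS' ->]]; rewrite joinEprod /= !joinEtotal.
apply/allpairsP; exists (Num.max a a', Num.max b b'); split=> //=.
  by rewrite maxElt; case: ifP.
by rewrite maxElt; case: ifP.
Qed.

(** * Moving a line *)

Section Follows.
Context {R : realType}.
Implicit Types (a b tau : R).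

(** A segment from [a] to [b] keeps the sign of [a] until its end, where a nonzero value may become
    zero. *)
Definition follows a b : Prop := (a = 0 -> b = 0) /\ 0 <= a * b.

Lemma follows_refl a : follows a a.
Proof. by split=> //; rewrite -expr2 sqr_ge0. Qed.

Lemma follows_sg a b tau : follows a b -> 0 <= tau < 1 ->
  Num.sg ((1 - tau) * a + tau * b) = Num.sg a.
Proof.
move=> [ab0 ab] /andP[tau0 tau1]; have t1 : 0 < 1 - tau by rewrite subr_gt0.
case: (ltgtP a 0) => a0.
- have b0 : b <= 0 by move: ab; rewrite nmulr_rge0.
  rewrite (ltr0_sg a0) ltr0_sg //; apply: ltr_wnDr.
    by rewrite mulr_ge0_le0.
  by rewrite pmulr_rlt0.
- have b0 : 0 <= b by move: ab; rewrite pmulr_rge0.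
  rewrite (gtr0_sg a0) gtr0_sg //; apply: ltr_wpDr.
    by rewrite mulr_ge0.
  by rewrite mulr_gt0.
- by rewrite (ab0 a0) a0 !mulr0 addr0.
Qed.

Lemma dist_max (x y z : R) : `|Num.max z x - Num.max z y| <= `|x - y|.
Proof.
wlog xy : x y / x <= y => [h|].
  by have [/h//|/ltW/h] := leP x y; rewrite distrC (distrC y).
have mxy : Num.max z x <= Num.max z y by rewrite ge_max !le_max lexx xy orbT.
rewrite distrC (distrC x) !ger0_norm ?subr_ge0 //.
case: (leP z x) => zx; first by rewrite max_r // (le_trans zx).
by case: (leP z y) => zy; rewrite ?subrr ?subr_ge0 // lerB // ltW.
Qed.

(** Opposite strict orders at the ends are excluded, so one argument attains the maximum at both. *)
Lemma max_linear (x y x0 y0 x1 y1 tau : R) : 0 <= tau <= 1 ->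
  x = (1 - tau) * x0 + tau * x1 -> y = (1 - tau) * y0 + tau * y1 ->
  0 <= (y0 - x0) * (y1 - x1) ->
  Num.max x y = (1 - tau) * Num.max x0 y0 + tau * Num.max x1 y1.
Proof.
move=> /andP[tau0 tau1] -> -> same.
have t1 : 0 <= 1 - tau by rewrite subr_ge0.
case: (leP x0 y0) => h0; case: (leP x1 y1) => h1.
- by rewrite max_r // lerD // ler_wpM2l.
- have : (y0 - x0) * (y1 - x1) = 0.
    by apply/eqP; rewrite eq_le same andbT mulr_ge0_le0 ?subr_ge0 // subr_le0 ltW.
  move=> /eqP; rewrite mulf_eq0 !subr_eq0 (lt_eqF h1) orbF => /eqP ->.
  by rewrite max_l // lerD2l ler_wpM2l // ltW.
- have : (y0 - x0) * (y1 - x1) = 0.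
    by apply/eqP; rewrite eq_le same andbT mulr_le0_ge0 ?subr_ge0 // subr_le0 ltW.
  move=> /eqP; rewrite mulf_eq0 !subr_eq0 (lt_eqF h0) /= => /eqP ->.
  by rewrite max_l // lerD2r ler_wpM2l // ltW.
- by rewrite max_l // lerD // ler_wpM2l // ltW.
Qed.

End Follows.

Section CostConvex.
Context {R : realType} {A : eqType}.
Implicit Types (p q : A -> R).

Lemma eq_cost (S : seq A) p q t :
  {in S, p =1 q} -> triple_of S t -> cost p t = cost q t.
Proof. by move=> pq /and3P[uS vS _]; rewrite /cost !pq. Qed.

Lemma tcost_shift (S : seq A) p q (k : R) ot :
  (forall t, ot = Some t -> triple_of S t) -> {in S, forall u, q u = p u + k} ->
  tcost p ot = tcost q ot.
Proof.
case: ot => [t|] tS pq //; have /and3P[uS vS _] := tS t erefl.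
by rewrite /= /cost !pq // opprD addrACA subrr addr0.
Qed.

Lemma tcost_convex (S : seq A) p p0 p1 (tau : R) ot :
  (forall t, ot = Some t -> triple_of S t) -> 0 <= tau <= 1 ->
  {in S, forall u, p u = (1 - tau) * p0 u + tau * p1 u} ->
  (tcost p ot <= maxe (tcost p0 ot) (tcost p1 ot))%E.
Proof.
case: ot => [t|] tS /andP[tau0 tau1] pE; last by rewrite le_max lexx.
have t1 : 0 <= 1 - tau by rewrite subr_ge0.
rewrite /= -EFin_max lee_fin; have /and3P[uS vS _] := tS t erefl.
have le_t : cost p t <= (1 - tau) * cost p0 t + tau * cost p1 t.
  rewrite /cost !mulrA -mulrDl ler_wpM2r ?invr_ge0 // !pE //.
  have -> : (1 - tau) * p0 t.1.1 + tau * p1 t.1.1 -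
      ((1 - tau) * p0 t.1.2 + tau * p1 t.1.2) =
      (1 - tau) * (p0 t.1.1 - p0 t.1.2) + tau * (p1 t.1.1 - p1 t.1.2) by ring.
  apply: le_trans (ler_normD _ _) _.
  by rewrite !normrM (ger0_norm tau0) (ger0_norm t1).
apply: le_trans le_t _; set m := Num.max _ _.
have -> : m = (1 - tau) * m + tau * m by ring.
by rewrite lerD // ler_wpM2l // le_max lexx ?orbT.
Qed.

End CostConvex.

(** * Optimization over the lines *)

Section Optimization.
Context {R : realType} {F : fieldType}.
Variables (M N : pmod (plane R) F).
Variables (CM CN : set (plane R)) (Omega : set (ppoint R)).
Hypotheses (MP : propP M CM) (NP : propP N CN) (MNQ : propQ CM CN Omega).
Variables (SM SN A : seq (plane R)) (V : seq (R * R)).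
Hypothesis SME : forall u, lub_closure CM u <-> u \in SM.
Hypothesis SNE : forall u, lub_closure CN u <-> u \in SN.
Hypothesis AE : forall u,
  u \in A <-> (lub_closure CM `|` lub_closure CN) u \/ Omega (Affine u).
Hypothesis VE : forall v, v \in V <-> Omega (Infty v).
Variable x0 : plane R.
Hypothesis x0S : x0 \in SM ++ SN.

Local Notation W sw mu c := (weighted_bottleneck M N (slope_line sw mu c)).

Definition valid_pair (p : plane R -> R) T T' : Prop :=
  valid_template (max_rank M) SM p T /\ valid_template (max_rank N) SN p T'.

Lemma mix_bounds (mu0 mu1 tau : R) : 0 < mu0 <= 1 -> 0 <= mu1 <= 1 -> 0 <= tau < 1 ->
  0 < (1 - tau) * mu0 + tau * mu1 <= 1.
Proof.
move=> /andP[m00 m01] /andP[m10 m11] /andP[t0 t1].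
have t2 : 0 < 1 - tau by rewrite subr_gt0.
apply/andP; split; first by apply: ltr_wpDr; [exact: mulr_ge0|exact: mulr_gt0].
rewrite [leRHS](_ : _ = (1 - tau) * 1 + tau * 1); last by ring.
by rewrite lerD // ler_wpM2l // ltW.
Qed.

Lemma SA u : u \in SM ++ SN -> u \in A.
Proof.
by rewrite mem_cat => /orP[/SME|/SNE] h; apply/AE; left; [left|right].
Qed.

Lemma pair_template_in p T T' : valid_pair p T T' ->
  template_in (SM ++ SN) T /\ template_in (SM ++ SN) T'.
Proof.
move=> [[TS _ _] [TS' _ _]]; split=> x.
  by move=> /TS[x1 x2]; rewrite mem_cat x1; split=> // v /x2 vS; rewrite mem_cat vS.
move=> /TS'[x1 x2]; rewrite mem_cat x1 orbT; split=> // v /x2 vS.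
by rewrite mem_cat vS orbT.
Qed.

Lemma pair_coarsen p q T T' :
  coarsens (SM ++ SN) p q -> valid_pair p T T' -> valid_pair q T T'.
Proof.
move=> pq [vT vT']; split; [apply: valid_coarsen vT|apply: valid_coarsen vT'];
  by move=> u v uS vS; apply: pq; rewrite mem_cat ?uS ?vS ?orbT.
Qed.

(** Costs along the line are [mu^-1] times those of the heights, and the weight [mhat = mu] cancels
    this factor. *)
Lemma weighted_height sw mu c : 0 < mu <= 1 ->
  exists T T', valid_pair (height sw mu c) T T' /\
    W sw mu c = tbot (height sw mu c) T T'.
Proof.
move=> h; have /andP[mu0 _] := h; set L := slope_line sw mu c.
have [T [vT TE]] := line_template MP SME L.
have [T' [vT' TE']] := line_template NP SNE L.
have pE u : push_param L u = mu^-1 * (height sw mu c u - c / (1 + mu)).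
  exact: push_slope.
have vp : valid_pair (height sw mu c) T T'.
  apply: (@pair_coarsen (push_param L)) => // u v _ _.
  by rewrite !pE ler_pM2l ?invr_gt0 // lerD2r.
exists T, T'; split=> //; have [TS TS'] := pair_template_in vp.
have [[_ wT _] [_ wT' _]] := vp; have [_ wT1 _] := vT; have [_ wT1' _] := vT'.
rewrite /weighted_bottleneck -/L -TE -TE' -[bottleneck _ _]/(tbot _ _ _).
rewrite (mhat_slope _ _ h).
have costE t : cost (push_param L) t = mu^-1 * cost (height sw mu c) t.
  rewrite /cost !pE -mulrBr opprB addrA subrK normrM.
  by rewrite ger0_norm ?invr_ge0 ?ltW // mulrA.
have mun : mu != 0 by rewrite gt_eqF.
apply/eqP; rewrite eq_le; apply/andP; split.
  have le1 : (tbot (push_param L) T T' <= mu^-1%:E * tbot (height sw mu c) T T')%E.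
    by apply: (le_tbot TS TS') => //; [rewrite invr_gt0|move=> t _; rewrite costE].
  apply: le_trans (lee_wpmul2l _ le1) _; first by rewrite lee_fin ltW.
  by rewrite muleA -EFinM mulfV // mul1e.
apply: (le_tbot TS TS') => // t _.
by rewrite costE mulrA mulfV // mul1r.
Qed.

Lemma weighted_valid sw mu c T T' : 0 < mu <= 1 ->
  valid_pair (height sw mu c) T T' -> W sw mu c = tbot (height sw mu c) T T'.
Proof.
move=> h [vT vT']; have [T1 [T1' [[vT1 vT1'] ->]]] := weighted_height sw c h.
exact: tbot_valid vT1 vT vT1' vT'.
Qed.

(** No point of the configuration, finite or at infinity, is crossed on the way; only the end line
    may meet new ones. *)
Definition admissible sw (mu0 c0 mu1 c1 : R) : Prop :=
  {in A, forall u, follows (above sw mu0 c0 u) (above sw mu1 c1 u)} /\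
  {in V, forall v, follows (above sw mu0 0 v) (above sw mu1 0 v)}.

Lemma height_linear sw (mu0 c0 mu1 c1 tau : R) u : 0 <= tau <= 1 ->
  follows (above sw mu0 c0 u) (above sw mu1 c1 u) ->
  height sw ((1 - tau) * mu0 + tau * mu1) ((1 - tau) * c0 + tau * c1) u
  = (1 - tau) * height sw mu0 c0 u + tau * height sw mu1 c1 u.
Proof.
move=> h [_ same]; apply: max_linear => //; [by ring|by ring|].
by move: same; rewrite /above !opprD !addrA.
Qed.

(** [above] is affine in [(mu, c)], so its signs are constant before the end, and [recip] depends
    only on them. *)
Lemma line_equiv_admissible sw (mu0 c0 mu1 c1 tau : R) :
  0 < mu0 <= 1 -> 0 <= mu1 <= 1 -> admissible sw mu0 c0 mu1 c1 -> 0 <= tau < 1 ->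
  line_equiv ((@Affine R) @` (lub_closure CM `|` lub_closure CN) `|` Omega)
    (slope_line sw ((1 - tau) * mu0 + tau * mu1) ((1 - tau) * c0 + tau * c1))
    (slope_line sw mu0 c0).
Proof.
move=> h0 h1 [admA admV] tau01; set mu := _ + _.
have hmu : 0 < mu <= 1 by exact: mix_bounds.
have affine u : u \in A -> recip (slope_line sw mu ((1 - tau) * c0 + tau * c1)) (Affine u)
    = recip (slope_line sw mu0 c0) (Affine u).
  move=> uA; rewrite !recip_affine //; congr recip_sign.
  rewrite -(follows_sg (admA u uA) tau01); congr Num.sg.
  by rewrite /above /mu; ring.
move=> p [[u Su <-]|]; first by apply: affine; apply/AE; left.
case: p => [u|v] Op; first by apply: affine; apply/AE; right.
have [_ /(_ v Op)[v1 v2] _] := MNQ.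
rewrite !recip_infty //; congr recip_sign.
have vV : v \in V by apply/VE.
rewrite -(follows_sg (admV v vV) tau01); congr Num.sg.
by rewrite /above /mu; ring.
Qed.

(* A realizing triple at the start of an admissible move bounds the weighted
   bottleneck from below at its end, where [mu1 = 0] is allowed. *)
Lemma weighted_move sw (mu0 c0 : R) : 0 < mu0 <= 1 ->
  exists ot, [/\ forall t, ot = Some t -> triple_of (SM ++ SN) t,
    W sw mu0 c0 = tcost (height sw mu0 c0) ot &
    forall mu1 c1 : R, 0 <= mu1 <= 1 -> admissible sw mu0 c0 mu1 c1 ->
      exists T T', valid_pair (height sw mu1 c1) T T' /\
        (tcost (height sw mu1 c1) ot <= tbot (height sw mu1 c1) T T')%E].
Proof.
move=> h0; have [T [T' [vT WE]]] := weighted_height sw c0 h0.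
have [TS TS'] := pair_template_in vT.
have [[_ wT _] [_ wT' _]] := vT.
have [ot [otS botE otmin]] := tbot_attained TS TS' wT wT' x0S.
exists ot; split=> //; first by rewrite WE.
move=> mu1 c1 h1 adm; exists T, T'; have [admA admV] := adm.
(* Costs of heights and of pushes differ by the positive factor [mu], so the signs are those
   controlled by (Q) on equivalent lines. *)
have same_sign (tau : R) t t' : 0 <= tau < 1 ->
    triple_of (SM ++ SN) t -> triple_of (SM ++ SN) t' ->
    Num.sg (cost (segment (height sw mu0 c0) (height sw mu1 c1) tau) t
            - cost (segment (height sw mu0 c0) (height sw mu1 c1) tau) t')
    = Num.sg (cost (height sw mu0 c0) t - cost (height sw mu0 c0) t').
  move=> tau01 tS t'S; have /andP[tau0 tau1] := tau01.
  pose mu := (1 - tau) * mu0 + tau * mu1; pose c := (1 - tau) * c0 + tau * c1.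
  have segE : {in SM ++ SN,
      segment (height sw mu0 c0) (height sw mu1 c1) tau =1 height sw mu c}.
    move=> u /SA uA; symmetry; apply: height_linear; last exact: admA.
    by rewrite tau0 ltW.
  rewrite (eq_cost segE tS) (eq_cost segE t'S).
  have costE (m b : R) x : 0 < m <= 1 -> cost (height sw m b) x
      = m * cost (push_param (slope_line sw m b)) x.
    move=> hm; have /andP[m0 _] := hm; rewrite /cost !(push_slope _ _ _ hm).
    rewrite -mulrBr opprB addrA subrK normrM ger0_norm ?invr_ge0 ?(ltW m0) //.
    by rewrite !mulrA mulfV ?mul1r // gt_eqF.
  have leq := line_equiv_admissible h0 h1 adm tau01; rewrite -/mu -/c in leq.
  have hmu : 0 < mu <= 1 by exact: mix_bounds.
  have sgE (m b : R) : 0 < m <= 1 ->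
      Num.sg (cost (height sw m b) t - cost (height sw m b) t') =
      Num.sg (cost (push_param (slope_line sw m b)) t
              - cost (push_param (slope_line sw m b)) t').
    move=> hm; have /andP[m0 _] := hm.
    by rewrite (costE m b t hm) (costE m b t' hm) -mulrBr sgrM (gtr0_sg m0) mul1r.
  rewrite (sgE mu c hmu) (sgE mu0 c0 h0).
  clear sgE; case: t t' tS t'S => [[u v] d] [[u' v'] d'].
  move=> /and3P[/= uS vS dS] /and3P[/= uS' vS' dS'].
  have inS z : z \in SM ++ SN -> (lub_closure CM `|` lub_closure CN) z.
    by rewrite mem_cat => /orP[/SME|/SNE]; [left|right].
  have [_ _ Q] := MNQ.
  exact: (Q u v u' v' d d' (inS _ uS) (inS _ vS) (inS _ uS') (inS _ vS') dS dS' _ _ leq).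
have vT1 : valid_pair (height sw mu1 c1) T T'.
  apply: pair_coarsen vT; exact: segment_coarsens same_sign.
split=> //; have [[_ wT1 _] [_ wT1' _]] := vT1.
apply: otmin => //; exact: segment_cost_preserving same_sign.
Qed.


Lemma follows_pair (a b b' : R) : follows a b -> follows a b' -> 0 <= b * b'.
Proof.
move=> [ab0 ab] [_ ab']; have [a0|an0] := eqVneq a 0.
  by rewrite (ab0 a0) mul0r.
have a2 : 0 < a ^+ 2 by rewrite lt_neqAle eq_sym sqrf_eq0 an0 sqr_ge0.
rewrite -(pmulr_rge0 _ a2).
have -> : a ^+ 2 * (b * b') = (a * b) * (a * b') by ring.
exact: mulr_ge0.
Qed.

(** The offsets at both ends follow the one in the middle and hence do not have opposite signs, so
    the heights are affine on the whole segment. *)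
Lemma height_between sw (mu0 c0 mu1 c1 mu2 c2 tau : R) : 0 <= tau <= 1 ->
  admissible sw mu0 c0 mu1 c1 -> admissible sw mu0 c0 mu2 c2 ->
  mu0 = (1 - tau) * mu1 + tau * mu2 -> c0 = (1 - tau) * c1 + tau * c2 ->
  {in SM ++ SN, forall u, height sw mu0 c0 u
    = (1 - tau) * height sw mu1 c1 u + tau * height sw mu2 c2 u}.
Proof.
move=> htau [adm1 _] [adm2 _] -> -> u /SA uA.
apply: max_linear => //; [by ring|by ring|].
have := follows_pair (adm1 u uA) (adm2 u uA).
by rewrite /above !opprD !addrA.
Qed.

Lemma admissible_shift sw (mu c k : R) :
  {in A, forall u, follows (above sw mu c u) (above sw mu c u - k)} ->
  admissible sw mu c mu (c + k).
Proof.
move=> h; split=> [u uA|v _]; last exact: follows_refl.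
by have := h u uA; rewrite /above opprD addrA.
Qed.

(** The line is translated both ways until it first meets a point of [A], and convexity selects an
    end. With points on one side only, the realizing cost stays constant on the way. *)
Lemma reach_affine sw (mu c : R) : 0 < mu <= 1 ->
  exists2 a, a \in A & (W sw mu c <= W sw mu (ordi sw a - mu * absc sw a))%E.
Proof.
move=> h; have /andP[mu0 mu1] := h; have h' : 0 <= mu <= 1 by rewrite ltW.
have throughE a : ordi sw a - mu * absc sw a = c + above sw mu c a.
  by rewrite /above; ring.
have [/hasP[a aA /eqP a0]|none] := boolP (has (fun u => above sw mu c u == 0) A).
  by exists a => //; rewrite throughE a0 addr0.
have {}none u : u \in A -> above sw mu c u != 0.
  by move=> uA; apply: contra none => u0; apply/hasP; exists u.
have [ot [otS WE otmove]] := weighted_move sw c h.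
have up_ok k : 0 <= k -> (forall u, u \in A -> 0 < above sw mu c u ->
    k <= above sw mu c u) -> admissible sw mu c mu (c + k).
  move=> k0 kmin; apply: admissible_shift => u uA; split=> [u0|].
    by have := none u uA; rewrite u0 eqxx.
  case: (ltP 0 (above sw mu c u)) => [pos|neg].
    by apply: mulr_ge0; [exact: ltW|rewrite subr_ge0; exact: kmin].
  by rewrite mulr_le0 // subr_le0 (le_trans neg).
have dn_ok k : k <= 0 -> (forall u, u \in A -> above sw mu c u < 0 ->
    above sw mu c u <= k) -> admissible sw mu c mu (c + k).
  move=> k0 kmax; apply: admissible_shift => u uA; split=> [u0|].
    by have := none u uA; rewrite u0 eqxx.
  case: (ltP (above sw mu c u) 0) => [neg|pos].
    by apply: mulr_le0; [exact: ltW|rewrite subr_le0; exact: kmax].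
  by rewrite mulr_ge0 // subr_ge0 (le_trans k0).
have reach k : admissible sw mu c mu (c + k) ->
    (tcost (height sw mu (c + k)) ot <= W sw mu (c + k))%E.
  by move=> /(otmove _ _ h')[T [T' [vT le_t]]]; rewrite (weighted_valid h vT).
have [/(seq_argmin (above sw mu c))[a [aA a0 amin]]|noup] :=
    boolP (has (fun u => 0 < above sw mu c u) A);
  have [/(seq_argmax (above sw mu c))[b [bA b0 bmax]]|nodn] :=
    boolP (has (fun u => above sw mu c u < 0) A).
- have adma := up_ok _ (ltW a0) amin; have admb := dn_ok _ (ltW b0) bmax.
  set ka := above sw mu c a in a0 amin adma *.
  set kb := above sw mu c b in b0 bmax admb *.
  (* The weight that writes [c] as a mean of [c + kb] and [c + ka]. *)
  pose tau := - kb / (ka - kb).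
  have kk : 0 < ka - kb by rewrite subr_gt0 (lt_trans b0).
  have htau : 0 <= tau <= 1.
    apply/andP; split; last by rewrite ler_pdivrMr // mul1r lerDr ltW.
    by apply: divr_ge0; [rewrite oppr_ge0|]; exact: ltW.
  have btw := height_between htau admb adma.
  have := tcost_convex otS htau (btw _ _); rewrite -WE => /(_ _ _) le_W.
  have {le_W} : (W sw mu c <= maxe (W sw mu (c + kb)) (W sw mu (c + ka)))%E.
    apply: le_trans (le_W _ _) _; [by ring| |].
      by rewrite /tau; field; rewrite gt_eqF.
    by rewrite ge_max !le_max !reach ?orbT.
  rewrite le_max => /orP[le_b|le_a].
    by exists b; rewrite // throughE.
  by exists a; rewrite // throughE.
(* All points lie above the line, so the heights are the ordinates and do not change with [c]. *)
- have adma := up_ok _ (ltW a0) amin; exists a; rewrite // throughE WE.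
  apply: le_trans (reach _ adma).
  rewrite (tcost_shift (q := height sw mu (c + above sw mu c a)) (k := 0) otS) //
    => u /SA uA.
  have pos : 0 < above sw mu c u.
    by have := none u uA; rewrite neq_lt => /orP[neg|//]; case/hasP: nodn; exists u.
  have := amin u uA pos; move: pos; move: (above sw mu c a) => ka.
  rewrite /above /height addr0 => pos le_k.
  by rewrite !max_r //; lra.
(* All points lie below the line, so all heights change by the same amount as [c]. *)
- have admb := dn_ok _ (ltW b0) bmax; exists b; rewrite // throughE WE.
  apply: le_trans (reach _ admb).
  rewrite (tcost_shift (q := height sw mu (c + above sw mu c b))
    (k := above sw mu c b) otS) // => u /SA uA.
  have neg : above sw mu c u < 0.
    by have := none u uA; rewrite neq_lt => /orP[//|pos]; case/hasP: noup; exists u.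
  have := bmax u uA neg; move: neg; move: (above sw mu c b) => kb.
  rewrite /above /height => neg le_k.
  by rewrite !max_l ?addrA //; lra.
- have /none : x0 \in A by exact: SA.
  rewrite neq_lt => /orP[neg|pos].
    by case/hasP: nodn; exists x0 => //; exact: SA.
  by case/hasP: noup; exists x0 => //; exact: SA.
Qed.


(* Slopes of the lines through [a] and a second point of the configuration; a
   zero denominator yields 0, which is not a slope. *)
Definition slopes sw a : seq R :=
  1 :: [seq (ordi sw b - ordi sw a) / (absc sw b - absc sw a) | b <- A]
    ++ [seq ordi sw v / absc sw v | v <- V].

Definition through sw (a : plane R) (mu : R) : R := ordi sw a - mu * absc sw a.

(** [D] and [E] are coordinate differences to the centre of rotation, or the coordinates of a point
    at infinity; the offset can change sign only at the slope [D / E]. *)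
Lemma follows_rotation (D E mu0 mu1 : R) :
  (E != 0 -> mu0 != D / E) ->
  (E != 0 -> ~~ (mu0 < D / E < mu1) && ~~ (mu1 < D / E < mu0)) ->
  follows (D - mu0 * E) (D - mu1 * E).
Proof.
have [->|En0] := eqVneq E 0.
  by move=> _ _; rewrite !mulr0 subr0; exact: follows_refl.
set m := D / E; have -> : D = m * E by rewrite divfK.
move=> /(_ isT) mu0m /(_ isT)/andP[no1 no2]; rewrite -!mulrBl; split.
  by move/eqP; rewrite mulf_eq0 (negbTE En0) orbF subr_eq0 eq_sym (negbTE mu0m).
have -> : (m - mu0) * E * ((m - mu1) * E) = (m - mu0) * (m - mu1) * E ^+ 2 by ring.
apply: mulr_ge0; last exact: sqr_ge0.
move: mu0m; rewrite neq_lt => /orP[lt_m|lt_m].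
  rewrite lt_m -leNgt /= in no1.
  by apply: mulr_ge0; rewrite subr_ge0 // ltW.
rewrite lt_m andbT -leNgt in no2.
by apply: mulr_le0; rewrite subr_le0 // ltW.
Qed.

Lemma rotation_admissible sw a (mu0 mu1 : R) : mu0 \notin slopes sw a ->
  (forall m, m \in slopes sw a -> ~~ (mu0 < m < mu1) && ~~ (mu1 < m < mu0)) ->
  admissible sw mu0 (through sw a mu0) mu1 (through sw a mu1).
Proof.
move=> mu0n nobtw; split=> [u uA|v vV].
  have aboveE m : above sw m (through sw a m) u
      = (ordi sw u - ordi sw a) - m * (absc sw u - absc sw a).
    by rewrite /above /through; ring.
  have mS : (ordi sw u - ordi sw a) / (absc sw u - absc sw a) \in slopes sw a.
    rewrite inE mem_cat; apply/orP; right; apply/orP; left.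
    by apply/mapP; exists u.
  rewrite !aboveE; apply: follows_rotation => // _; last exact: nobtw.
  by apply: contraNneq mu0n => ->.
have mS : ordi sw v / absc sw v \in slopes sw a.
  rewrite inE mem_cat; apply/orP; right; apply/orP; right.
  by apply/mapP; exists v.
rewrite /above !subr0; apply: follows_rotation => // _; last exact: nobtw.
by apply: contraNneq mu0n => ->.
Qed.

(** The line is rotated about [a] to the neighbouring entries of [slopes]. The entry 1 guarantees
    one above [mu]; below, 0 may have to take its place. *)
Lemma reach_vertex sw a (mu : R) : a \in A -> 0 < mu <= 1 ->
  exists b nu, [/\ b \in A, nu \in slopes sw b, 0 < nu <= 1 &
    (W sw mu (through sw a mu) <= W sw nu (through sw b nu))%E].
Proof.
move=> aA h; have /andP[mu0 mu1] := h.
have [muS|muN] := boolP (mu \in slopes sw a); first by exists a, mu.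
have mu_lt1 : mu < 1.
  by rewrite lt_neqAle mu1 andbT; apply: contraNneq muN => ->; exact: mem_head.
have [|mp [mpS mu_mp mpmin]] := @seq_argmin _ _ _ (@id R) (fun m => mu < m) (slopes sw a).
  by apply/hasP; exists 1; rewrite ?mem_head.
have hp : 0 < mp <= 1.
  by rewrite (lt_trans mu0 mu_mp); apply: mpmin; rewrite ?mem_head.
have hp' : 0 <= mp <= 1 by case/andP: hp => /ltW-> ->.
have admp : admissible sw mu (through sw a mu) mp (through sw a mp).
  apply: rotation_admissible => // m mS; rewrite !negb_and -!leNgt.
  have [le_m|lt_m] := leP m mu; first by rewrite (le_trans le_m (ltW mu_mp)).
  by have /= -> := mpmin m mS lt_m; rewrite (ltW lt_m) orbT.
have [ot [otS WE otmove]] := weighted_move sw (through sw a mu) h.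
have [T [T' [vT le_p]]] := otmove _ _ hp' admp.
rewrite -(weighted_valid hp vT) in le_p.
have between mm : mm < mu -> admissible sw mu (through sw a mu) mm (through sw a mm) ->
    (W sw mu (through sw a mu) <=
     maxe (tcost (height sw mm (through sw a mm)) ot) (W sw mp (through sw a mp)))%E.
  (* Since [through] is affine in the slope, one weight serves for slope and intercept. *)
  move=> mm_mu admm; pose tau := (mu - mm) / (mp - mm).
  have d0 : 0 < mp - mm by rewrite subr_gt0 (lt_trans mm_mu).
  have htau : 0 <= tau <= 1.
    apply/andP; split; last by rewrite ler_pdivrMr // mul1r lerD2r ltW.
    by apply: divr_ge0; [rewrite subr_ge0|]; exact: ltW.
  have btw := height_between htau admm admp.
  have := tcost_convex otS htau (btw _ _); rewrite -WE => le_W.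
  apply: le_trans (le_W _ _) _.
  - by rewrite /tau; field; rewrite gt_eqF.
  - by rewrite /tau /through; field; rewrite gt_eqF.
  by rewrite ge_max !le_max lexx le_p orbT.
have [|nolow] := boolP (has (fun m => 0 < m < mu) (slopes sw a)).
  move=> /(seq_argmax (@id R))[mm [mmS /andP[mm0 mm_mu] mmmax]].
  have hm : 0 < mm <= 1 by rewrite mm0 (le_trans (ltW mm_mu)).
  have hm' : 0 <= mm <= 1 by case/andP: hm => /ltW-> ->.
  have admm : admissible sw mu (through sw a mu) mm (through sw a mm).
    apply: rotation_admissible => // m mS; rewrite !negb_and -!leNgt.
    have [le_m|lt_m] := leP mu m; first by rewrite (le_trans (ltW mm_mu) le_m) !orbT.
    have [le_m|mm_m] := leP m mm; first by rewrite (ltW lt_m).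
    by rewrite leNgt; have := mmmax m mS; rewrite lt_m (lt_trans mm0 mm_m) => /(_ isT);
      rewrite leNgt mm_m.
  have [T1 [T1' [vT1 le_m]]] := otmove _ _ hm' admm.
  rewrite -(weighted_valid hm vT1) in le_m.
  have := between mm mm_mu admm; rewrite le_max => /orP[/le_trans le_W|le_W].
    by exists a, mm; split=> //; exact: le_W.
  by exists a, mp.
(* The limit [mu = 0] of the rotation is compared with the diagonal line through
   [b] below all other points. *)
have h0 : 0 <= (0 : R) <= 1 by apply/andP; split; [exact: lexx|exact: ler01].
have adm0 : admissible sw mu (through sw a mu) 0 (through sw a 0).
  apply: rotation_admissible => // m mS; rewrite !negb_and -!leNgt.
  have [le_m|lt_m] := leP mu m; first by rewrite (le_trans (ltW mu0) le_m) !orbT.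
  rewrite (ltW lt_m) /= orbF leNgt; apply: contra nolow => m0.
  by apply/hasP; exists m; rewrite ?m0.
have := between 0 mu0 adm0; rewrite le_max => /orP[le_W|le_W]; last by exists a, mp.
have [T1 [T1' [vT1 le_0]]] := otmove _ _ h0 adm0.
have [|b [bA _ bmin]] := @seq_argmin _ _ _ (fun u => ordi sw u - absc sw u) predT A.
  by apply/hasP; exists a.
have h1 : 0 < (1 : R) <= 1 by apply/andP; split; [exact: ltr01|exact: lexx].
exists b, 1; split=> //; first exact: mem_head.
apply: le_trans le_W (le_trans le_0 _).
have [T2 [T2' [vT2 ->]]] := weighted_height sw (through sw b 1) h1.
have hE : {in SM ++ SN, forall u, height sw 1 (through sw b 1) u = ordi sw u}.
  move=> u /SA uA; have := bmin u uA isT; rewrite /height /through => le_u.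
  by rewrite max_r //; lra.
have h0E u : height sw 0 (through sw a 0) u = Num.max (ordi sw a) (ordi sw u).
  by rewrite /height /through !mul0r add0r subr0.
(* Truncation from below is monotone, so the names valid on the diagonal stay valid at slope 0 and
   may replace those found by the rotation. *)
have vT2' : valid_pair (height sw 0 (through sw a 0)) T2 T2'.
  apply: pair_coarsen vT2 => u v uS vS; rewrite !hE // !h0E => uv.
  by rewrite ge_max !le_max lexx uv orbT.
have -> : tbot (height sw 0 (through sw a 0)) T1 T1'
    = tbot (height sw 0 (through sw a 0)) T2 T2'.
  exact: tbot_valid vT1.1 vT2'.1 vT1.2 vT2'.2.
have [TS TS'] := pair_template_in vT2.
rewrite -[leRHS]mul1e; apply: (le_tbot TS TS').
- by case: vT2 => -[].
- by case: vT2 => _ [].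
- by case: vT2' => -[].
- by case: vT2' => _ [].
- exact: ltr01.
move=> t /and3P[uS vS _]; rewrite mul1r /cost !h0E !hE //.
by rewrite ler_wpM2r ?invr_ge0 // dist_max.
Qed.

Lemma vertex_dominates L : exists sw b nu,
  [/\ b \in A, nu \in slopes sw b, 0 < nu <= 1 &
    (weighted_bottleneck M N L <= W sw nu (through sw b nu))%E].
Proof.
have [sw [mu [c [h ->]]]] := slope_line_surj L.
have [a aA le_a] := reach_affine sw c h.
have [b [nu [bA nuS hnu le_b]]] := reach_vertex sw aA h.
by exists sw, b, nu; split=> //; exact: le_trans le_b.
Qed.

(** The entry 1 comes from the direction [Infty (1, 1)], any other from a second point; a zero
    denominator would give the slope 0, against [0 < nu]. *)
Lemma vertex_two_points sw b nu :
  b \in A -> nu \in slopes sw b -> 0 < nu <= 1 ->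
  exists p q : ppoint R,
    [/\ ((@Affine R) @` (lub_closure CM `|` lub_closure CN)
         `|` (Omega `&` range (@Affine R))) p,
        ((@Affine R) @` (lub_closure CM `|` lub_closure CN)
         `|` (Omega `|` [set Infty (1, 1)])) q, p <> q,
        on_line (slope_line sw nu (through sw b nu)) p &
        on_line (slope_line sw nu (through sw b nu)) q].
Proof.
move=> bA nuS h; have /andP[nu0 _] := h; exists (Affine b).
have bP : ((@Affine R) @` (lub_closure CM `|` lub_closure CN)
    `|` (Omega `&` range (@Affine R))) (Affine b).
  have /AE[Sb|Ob] := bA; first by left; exists b.
  by right; split=> //; exists b.
have bL : on_line (slope_line sw nu (through sw b nu)) (Affine b).
  by apply/on_slope_affine => //; rewrite /above /through; ring.
move: nuS; rewrite inE mem_cat => /orP[/eqP nu1|/orP[/mapP[a aA nuE]|/mapP[v vV nuE]]].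
- exists (Infty (1, 1)); split=> //; first by right; right.
  by apply/on_slope_infty => //; rewrite /above nu1; case: (sw) => /=; ring.
- have En0 : absc sw a - absc sw b != 0.
    by apply: contraTneq nu0 => E0; rewrite nuE E0 invr0 mulr0 ltxx.
  exists (Affine a); split=> //.
  + have /AE[Sa|Oa] := aA; first by left; exists a.
    by right; left.
  + by move=> [ba]; rewrite ba subrr eqxx in En0.
  + apply/on_slope_affine => //.
    have -> : above sw nu (through sw b nu) a
        = (ordi sw a - ordi sw b) - nu * (absc sw a - absc sw b).
      by rewrite /above /through; ring.
    by rewrite nuE divfK // subrr.
- have En0 : absc sw v != 0.
    by apply: contraTneq nu0 => E0; rewrite nuE E0 invr0 mulr0 ltxx.
  exists (Infty v); split=> //; first by right; left; apply/VE.
  by apply/on_slope_infty => //; rewrite /above nuE divfK // subrr subr0.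
Qed.

(** The candidates form a finite list, nonempty because of [x0] and the slope 1, and every line is
    dominated by one of them. *)
Lemma vertex_maximal : exists sw b nu,
  [/\ b \in A, nu \in slopes sw b, 0 < nu <= 1 &
    matching_distance M N = W sw nu (through sw b nu)].
Proof.
pose vs : seq (bool * (plane R) * R) :=
  [seq (z, m) | z <- [seq (sw, b) | sw <- [:: true; false], b <- A],
                m <- slopes z.1 z.2].
pose ok (v : bool * (plane R) * R) := 0 < v.2 <= 1.
pose val (v : bool * (plane R) * R) : \bar R :=
  W v.1.1 v.2 (through v.1.1 v.1.2 v.2).
have mem_vs sw b m : b \in A -> m \in slopes sw b -> ((sw, b), m) \in vs.
  move=> bA mS; apply/allpairsPdep; exists (sw, b), m; split=> //.
  by apply/allpairsP; exists (sw, b); split=> //; case: (sw).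
have [|[[sw b] nu] [vin okv vmax]] := @seq_argmax _ _ _ val ok vs.
  have xA : x0 \in A by exact: SA.
  apply/hasP; exists ((true, x0), 1); last by rewrite /ok /= ltr01 lexx.
  by apply: mem_vs => //; exact: mem_head.
have [bA nuS] : b \in A /\ nu \in slopes sw b.
  move: vin => /allpairsPdep[[sw' b'] [m [/allpairsP[[sw2 b2] /= [_ b2A [-> ->]]] mS]]].
  by case=> -> -> ->.
exists sw, b, nu; split=> //; apply/eqP; rewrite eq_le; apply/andP; split.
  apply: ub_ereal_sup => _ [L _ <-].
  have [sw' [b' [nu' [bA' nuS' h' le_L]]]] := vertex_dominates L.
  apply: le_trans le_L _.
  exact: (vmax ((sw', b'), nu') (mem_vs _ _ _ bA' nuS') h').
by apply: ereal_sup_ubound; exists (slope_line sw nu (through sw b nu)).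
Qed.

End Optimization.

(** A bar would make the space at its birth nonzero. *)
Lemma dgm_trivial {R : realType} {F : fieldType} (M : pmod (plane R) F) L :
  pm_trivial M -> dgm (line_restr M L) = [::].
Proof.
move=> M0; rewrite /dgm; case: xgetP => // -[//|p D] _ Ddgm.
have := pm_rank_dgm (lexx p.1) Ddgm; rewrite pm_rank_refl.
have -> : fullv = 0%VS :> {vspace line_restr M L p.1}.
  apply/eqP; rewrite -subv0; apply/subvP => x _.
  by rewrite (M0 _ x) mem0v.
rewrite dimv0 /= /alive lexx; case: Ddgm => /= /andP[-> _] _.
by [].
Qed.

Lemma matching_distance_trivial {R : realType} {F : fieldType}
    (M N : pmod (plane R) F) :
  pm_trivial M -> pm_trivial N -> matching_distance M N = 0%E.
Proof.
move=> M0 N0; rewrite /matching_distance.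
have W0 L : weighted_bottleneck M N L = 0%E.
  rewrite /weighted_bottleneck !dgm_trivial //.
  suff -> : bottleneck [::] [::] = 0%E :> \bar R by rewrite mule0.
  apply/eqP; rewrite eq_le bottleneck_ge0 andbT.
  by apply: matched_bottleneck => //; exists [::], [::], [::].
suff -> : [set weighted_bottleneck M N L | L in [set: line R]] = [set 0%E].
  exact: ereal_sup1.
apply/seteqP; split=> [_ [L _ <-]|_ ->]; first by rewrite W0.
(* Some line has to be exhibited, as the supremum of the empty set would be [-oo]. *)
by exists (slope_line false 1 0).
Qed.

Theorem theorem3p1 (R : realType) (F : fieldType) (M N : pmod (plane R) F) :
  finitely_presented M -> finitely_presented N ->
  (pm_trivial M -> pm_trivial N -> matching_distance M N = 0%E) /\
  (~ (pm_trivial M /\ pm_trivial N) ->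
   forall (CM CN : set (plane R)) (Omega : set (ppoint R)),
     propP M CM -> propP N CN -> propQ CM CN Omega ->
     exists (L : line R) (p q : ppoint R),
       [/\ ((@Affine R) @` (lub_closure CM `|` lub_closure CN)
            `|` (Omega `&` range (@Affine R))) p,
           ((@Affine R) @` (lub_closure CM `|` lub_closure CN)
            `|` (Omega `|` [set Infty (1, 1)])) q,
           p <> q, on_line L p /\ on_line L q &
           matching_distance M N = weighted_bottleneck M N L]).
Proof.
move=> _ _; split; first exact: matching_distance_trivial.
move=> nontriv CM CN Omega MP NP MNQ.
have [CMfin CM0 _] := MP; have [CNfin CN0 _] := NP; have [Ofin _ _] := MNQ.
have [SM SME] := lub_closure_finite CMfin.
have [SN SNE] := lub_closure_finite CNfin.
have /finite_seqP[OA OAE] : finite_set [set u | Omega (Affine u)].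
  by apply: finite_preimage Ofin => u v _ _ [].
have /finite_seqP[V VE] : finite_set [set v | Omega (Infty v)].
  by apply: finite_preimage Ofin => u v _ _ [].
have AE u : u \in (SM ++ SN) ++ OA <->
    (lub_closure CM `|` lub_closure CN) u \/ Omega (Affine u).
  have -> : Omega (Affine u) = (u \in OA) := congr1 (fun X : set _ => X u) OAE.
  rewrite !mem_cat; split; last by case=> [[/SME|/SNE]|] ->; rewrite ?orbT.
  by case/orP=> [/orP[/SME|/SNE]|] h; [left; left|left; right|right].
have VE' v : v \in V <-> Omega (Infty v).
  by have -> : Omega (Infty v) = (v \in V) := congr1 (fun X : set _ => X v) VE.
(* Without critical values both modules would be trivial by Property (P). *)
have [x xS] : exists x, x \in SM ++ SN.
  apply: contrapT => no; apply: nontriv; split; [apply/CM0|apply/CN0].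
    apply/seteqP; split=> // u Cu; apply: no; exists u; rewrite mem_cat.
    by apply/orP; left; apply/SME; apply: (@sub_smallest _ _ CM CM).
  apply/seteqP; split=> // u Cu; apply: no; exists u; rewrite mem_cat.
  by apply/orP; right; apply/SNE; apply: (@sub_smallest _ _ CN CN).
have [sw [b [nu [bA nuS h ->]]]] := vertex_maximal MP NP MNQ SME SNE AE VE' xS.
have [p [q [pP qP pq pL qL]]] := vertex_two_points AE VE' bA nuS h.
by exists (slope_line sw nu (through sw b nu)), p, q.
Qed.
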